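(* For every integer $n \ge 2$, there exist a pseudoconvex domain $\Omega \subset \mathbb{C}^n$ and a nonempty open set $\omega \subset \Omega$ such that the following assertions hold true: (1) There exists a function $\varphi \in \mathcal{PSH}(\Omega) \cap L^\infty_{loc}(\Omega)$ such that $\varphi < 0$ on $\Omega$ and $\varphi$ is strictly plurisubharmonic on $\omega$. (2) Every function $\varphi \in \mathcal{PSH}(\Omega) \cap \mathcal{C}^0(\Omega)$ such that $\varphi < 0$ on $\Omega$ is constant on $\omega$. In particular, $\mathfrak{c}^\ast(\Omega) \neq \mathfrak{c}^0(\Omega)$.
   Context: For a domain $\Omega \subset \mathbb{C}^n$, $\mathcal{PSH}(\Omega)$ denotes the set of plurisubharmonic functions on $\Omega$, $L^\infty_{loc}(\Omega)$ denotes the set of locally bounded functions on $\Omega$, $\mathcal{PSH}^\ast(\Omega) := \mathcal{PSH}(\Omega) \cap L^\infty_{loc}(\Omega)$, and $\mathcal{PSH}^0(\Omega) := \mathcal{PSH}(\Omega) \cap \mathcal{C}^0(\Omega)$. A function $\varphi \colon \Omega \to [-\infty, \infty)$, $\varphi \not\equiv -\infty$, is called strictly plurisubharmonic if for every $\mathcal{C}^\infty$-smooth function $\theta \colon \Omega \to \mathbb{R}$ with compact support there exists a constant $\varepsilon_0 > 0$ such that for all $\varepsilon \in (-\varepsilon_0, \varepsilon_0)$ the function $\varphi + \varepsilon\theta$ is plurisubharmonic on $\Omega$. The same definition is applied on open subsets: $\varphi$ is strictly plurisubharmonic on an open set $U \subset \Omega$ if its restriction to $U$ satisfies this condition with $U$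 in place of $\Omega$. We say that $\varphi$ is strictly plurisubharmonic near a point $z \in \Omega$ if $\varphi$ is strictly plurisubharmonic on some open neighborhood $U \subset \Omega$ of $z$. The core $\mathfrak{c}^\ast(\Omega)$ (respectively $\mathfrak{c}^0(\Omega)$) is the set of all $z \in \Omega$ such that every function $\varphi \in \mathcal{PSH}^\ast(\Omega)$ (respectively $\varphi \in \mathcal{PSH}^0(\Omega)$) that is bounded from above fails to be strictly plurisubharmonic near $z$. *)

(* Defs.v *)
From mathcomp Require Import all_boot all_order all_algebra.
From mathcomp Require Import complex.
From mathcomp Require Import all_classical all_reals all_analysis.

Set Implicit Arguments.
Unset Strict Implicit.
Unset Printing Implicit Defensive.

Import Order.TTheory GRing.Theory Num.Theory.
Import numFieldNormedType.Exports.

#[global] Open Scope classical_set_scope.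
#[global] Open Scope complex_scope.
#[global] Open Scope ring_scope.

(* [R[i]] itself carries no topology in the library; its regular module
   [R[i]^o] does (the one of the modulus), and ['rV[R[i]^o]_n] then has the
   sup-norm topology, that is, the usual topology of C^n. *)
Notation "''CC[' R ]_ n" := ('rV[(complex R)^o]_n)
  (at level 8, n at level 2, format "''CC[' R ]_ n") : type_scope.

(* Functions on an open set U are represented by total functions; every notion
   below is meant for U open and depends only on the values on U. *)

Definition usc_on (R : realType) (T : topologicalType) (U : set T)
    (u : T -> \bar R) : Prop :=
  forall z, U z -> forall a : R,
    (u z < a%:E)%E -> \forall w \near z, (u w < a%:E)%E.

(* A function identically -oo on a component of D counts as subharmonic. In the
   mean value the positive part of u is integrable on the circle, as u is
   bounded above there, so the integral is never an undetermined form. *)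
Definition subharmonic (R : realType) (D : set R[i]^o) (u : R[i]^o -> \bar R)
    : Prop :=
  [/\ forall z, D z -> (u z < +oo)%E,
      usc_on D u
    & forall (z : R[i]^o) (r : R), 0 < r ->
        [set w : R[i]^o | `|w - z| <= r%:C] `<=` D ->
        (u z <= ((2 * pi)^-1)%:E *
           \int[lebesgue_measure]_(t in `[0%R, (2 * pi)%R])
              u (z + r%:C * (cos t +i* sin t))%R)%E].

Definition psh (R : realType) (n : nat) (U : set 'CC[R]_n)
    (phi : 'CC[R]_n -> \bar R) : Prop :=
  [/\ forall z, U z -> (phi z < +oo)%E,
      usc_on U phi
    & forall a b : 'CC[R]_n,
        subharmonic [set zeta : R[i]^o | U (a + zeta *: b)]
                    (fun zeta => phi (a + zeta *: b))].

Definition locally_bounded_on (R : realType) (n : nat) (U : set 'CC[R]_n)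
    (phi : 'CC[R]_n -> \bar R) : Prop :=
  forall z, U z -> exists M : R, \forall w \near z, (`|phi w| <= M%:E)%E.

(* Continuous as a finite-valued function: the value -oo is excluded. *)
Definition continuous_real_on (R : realType) (n : nat) (U : set 'CC[R]_n)
    (phi : 'CC[R]_n -> \bar R) : Prop :=
  forall z, U z -> phi z \is a fin_num /\ {for z, continuous phi}.

Definition bounded_above_on (R : realType) (n : nat) (U : set 'CC[R]_n)
    (phi : 'CC[R]_n -> \bar R) : Prop :=
  exists M : R, forall z, U z -> (phi z <= M%:E)%E.

Definition real_line (R : realType) (n : nat) (f : 'CC[R]_n -> R)
    (z v : 'CC[R]_n) : R -> R :=
  fun t => f (z + (t%:C : R[i]^o) *: v).

(* C^k in the real sense, on C^n = R^(2n): v runs over all vectors of C^n, so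
   the derivatives along all real directions (v and 'i *: v alike) occur. *)
Fixpoint Ck_on (R : realType) (n : nat) (k : nat) (U : set 'CC[R]_n)
    (f : 'CC[R]_n -> R) : Prop :=
  (forall z, U z -> {for z, continuous f}) /\
  if k is k'.+1 then
    forall v : 'CC[R]_n,
      (forall z, U z -> derivable (real_line f z v) 0 1) /\
      Ck_on k' U (fun z => derive1 (real_line f z v) 0)
  else True.

Definition smooth_on (R : realType) (n : nat) (U : set 'CC[R]_n)
    (f : 'CC[R]_n -> R) : Prop :=
  forall k, Ck_on k U f.

Definition compact_support_in (R : realType) (n : nat) (U : set 'CC[R]_n)
    (f : 'CC[R]_n -> R) : Prop :=
  let S := closure [set z | U z /\ f z != 0] in compact S /\ S `<=` U.

Definition strictly_psh (R : realType) (n : nat) (U : set 'CC[R]_n)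
    (phi : 'CC[R]_n -> \bar R) : Prop :=
  [/\ forall z, U z -> (phi z < +oo)%E,
      exists z, U z /\ phi z <> -oo%E
    & forall theta : 'CC[R]_n -> R,
        smooth_on U theta -> compact_support_in U theta ->
        exists eps0 : R, 0 < eps0 /\
          forall eps : R, - eps0 < eps < eps0 ->
            psh U (fun z => phi z + (eps * theta z)%:E)%E].

Definition strictly_psh_near (R : realType) (n : nat) (Omega : set 'CC[R]_n)
    (phi : 'CC[R]_n -> \bar R) (z : 'CC[R]_n) : Prop :=
  exists U : set 'CC[R]_n,
    [/\ open U, U z, U `<=` Omega & strictly_psh U phi].

Definition PSH_star (R : realType) (n : nat) (Omega : set 'CC[R]_n)
    : set ('CC[R]_n -> \bar R) :=
  [set phi | psh Omega phi /\ locally_bounded_on Omega phi].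

Definition PSH_zero (R : realType) (n : nat) (Omega : set 'CC[R]_n)
    : set ('CC[R]_n -> \bar R) :=
  [set phi | psh Omega phi /\ continuous_real_on Omega phi].

Definition core_star (R : realType) (n : nat) (Omega : set 'CC[R]_n)
    : set 'CC[R]_n :=
  [set z | Omega z /\
     forall phi, PSH_star Omega phi -> bounded_above_on Omega phi ->
       ~ strictly_psh_near Omega phi z].

Definition core_zero (R : realType) (n : nat) (Omega : set 'CC[R]_n)
    : set 'CC[R]_n :=
  [set z | Omega z /\
     forall phi, PSH_zero Omega phi -> bounded_above_on Omega phi ->
       ~ strictly_psh_near Omega phi z].

Definition domain (R : realType) (n : nat) (Omega : set 'CC[R]_n) : Prop :=
  [/\ open Omega, connected Omega & Omega !=set0].

(* Existence of a continuous plurisubharmonic exhaustion function, i.e. one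
   whose sublevel sets are relatively compact in Omega. *)
Definition pseudoconvex (R : realType) (n : nat) (Omega : set 'CC[R]_n)
    : Prop :=
  exists rho : 'CC[R]_n -> R,
    [/\ forall z, Omega z -> {for z, continuous rho},
        psh Omega (fun z => (rho z)%:E)
      & forall c : R,
          let S := closure [set z | Omega z /\ rho z < c] in
          compact S /\ S `<=` Omega].

(* Main.v *)
Require Import Defs.
From mathcomp Require Import all_boot all_order all_algebra.
From mathcomp Require Import complex.
From mathcomp Require Import all_classical all_reals all_analysis.
From mathcomp Require Import measurable_realfun.
From mathcomp Require Import ring lra.
Import Order.TTheory GRing.Theory Num.Theory numFieldNormedType.Exports.

(** Write the points of [C^n] as [(z, w)] with [z] one of the coordinates. Let
    [p_0, p_1, ...] be dense in the unit circle and let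
      [V(z) = 2 |z|^2 + sum_j c_j (ln |z - p_j|^2 - 2 |z|^2 - 2)]
    with small weights [c_j > 0]: this is a subharmonic function on the plane,
    bounded near [0] and equal to [-oo] at all the [p_j]. The domain is the
    Hartogs domain [|w|^2 e^(V(z)) < 1], and the function of the first assertion
    is [|w|^2 e^V - 1], which lies between [-1] and [0] there.

    The domain contains the line [w = 0] and the affine subspaces [z = p_j], which
    are unions of lines that meet it. A continuous plurisubharmonic function that is
    bounded above is constant on each of these lines by Liouville's theorem for
    subharmonic functions ([liouville]). The lines over the [p_j] are dense over
    the unit circle, so continuity makes the function equal to one constant [c]
    on the part of the domain over the circle that has small [w]. By the maximum
    principle on the discs [w = const], it is at most [c] for [|z| <= 1] and small
    [w]; as it equals [c] on [w = 0], the maximum principle on the discs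
    [z = const] makes it equal to [c] ([constant_cylinder]). The function
    [|w|^2 e^V - 1] escapes this argument because it is only upper semicontinuous.

    To stay within finite continuous functions, [V] is replaced by the decreasing
    sequence [weight k] of finite sums in which [ln |z - p_j|^2] becomes
    [ln (|z - p_j|^2 + eps_k)]. All inequalities between values and circle means
    are proved for [dfun k = |w|^2 e^(weight k)] and pass to the limit
    ([psh_dfun_lim]). They rest on the mean value property of
    [ln |1 + s e^(it)|^2] ([mean_ln_onep]) and on Jensen's inequality for the
    exponential. Where [z] is small and [w] stays away from [0], the mean of
    [dfun k] over the circle with radius vector [d] exceeds the value at the
    centre by at least a multiple of [|d|^2] that does not depend on [k]
    ([dfun_gain]). On the other hand a smooth function with compact support deviates from its
    circle means by at most [K |d|^2] ([mean_test_function]). So a small multiple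
    of it can be added to [|w|^2 e^V - 1] without destroying
    plurisubharmonicity, which is strict plurisubharmonicity on a small ball
    [ball_omega].

    The domain is exhausted by [|x|^2 + sup_k (k^2 (dfun k - 1) + k)], a locally
    finite supremum ([pseudoconvex_Omega]). Finally, a function that is constant
    near a point is not strictly plurisubharmonic there, since adding a small bump
    creates a strict local maximum ([constant_not_strictly_psh]); hence the centre
    of the ball lies in the second core but not in the first. *)

Set Implicit Arguments.
Unset Strict Implicit.
Unset Printing Implicit Defensive.
Local Open Scope ring_scope.
Local Notation Re := (@complex.Re _).
Local Notation Im := (@complex.Im _).

(** * Means of periodic functions *)

Section Mean.
Variable R : realType.
Implicit Types (g h G : R -> R) (c : R).

Definition mean g : R :=
  (2 * pi)^-1 * \int[lebesgue_measure]_(t in `[0%R, (2 * pi)%R]) g t.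

Lemma twopi_gt0 : 0 < 2 * pi :> R.
Proof. by rewrite mulr_gt0 ?pi_gt0. Qed.

Lemma continuous_integrable g (a b : R) : continuous g ->
  lebesgue_measure.-integrable `[a, b]
    (EFin \o g : measurableTypeR R -> \bar R).
Proof.
move=> cg; apply: continuous_compact_integrable; first exact: segment_compact.
exact: continuous_subspaceT.
Qed.

Lemma meanE g : continuous g ->
  (((2 * pi)^-1)%:E * \int[lebesgue_measure]_(t in `[0%R, (2 * pi)%R])
     (g t)%:E)%E = (mean g)%:E.
Proof.
move=> cg; rewrite /mean EFinM /Rintegral fineK//.
by apply: integrable_fin_num => //; exact: continuous_integrable.
Qed.

Lemma meanD g h : continuous g -> continuous h ->
  mean (fun t => g t + h t) = mean g + mean h.
Proof.
move=> cg ch; rewrite /mean -mulrDr RintegralD//; exact: continuous_integrable.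
Qed.

Lemma meanZ c g : continuous g -> mean (fun t => c * g t) = c * mean g.
Proof.
move=> cg; rewrite /mean RintegralZl//; last exact: continuous_integrable.
by rewrite mulrCA.
Qed.

Lemma mean_cst c : mean (fun _ => c) = c.
Proof.
rewrite /mean Rintegral_cst//= lebesgue_measure_itv/= lte_fin twopi_gt0/=.
by rewrite subr0 mulrCA mulVf ?mulr1// gt_eqF// twopi_gt0.
Qed.

Lemma eq_mean g h : (forall t, g t = h t) -> mean g = mean h.
Proof. by move=> gh; congr mean; apply/funext. Qed.

Lemma mean_le g h : continuous g -> continuous h -> (forall t, g t <= h t) ->
  mean g <= mean h.
Proof.
move=> cg ch gh; rewrite /mean ler_pM2l ?invr_gt0 ?twopi_gt0//.
by apply: le_Rintegral => //; exact: continuous_integrable.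
Qed.

Lemma mean_le_cst g c : continuous g -> (forall t, g t <= c) -> mean g <= c.
Proof.
move=> cg gc; rewrite -[leRHS]mean_cst; apply: mean_le => // t; exact: cvg_cst.
Qed.

Lemma mean_ge_cst g c : continuous g -> (forall t, c <= g t) -> c <= mean g.
Proof.
move=> cg gc; rewrite -[leLHS]mean_cst; apply: mean_le => // t; exact: cvg_cst.
Qed.

(** Starting the integral at [-2] makes the primitive differentiable at [0], and
    its composite with the doubling map differentiable on [-1, +oo[. *)
Lemma primitive g : continuous g ->
  exists G, forall x : R, -2 < x -> is_derive x 1 G (g x).
Proof.
move=> cg; exists (fun x => \int[lebesgue_measure]_(t in `[(-2 : R), x]) g t).
move=> x x1.
have [dG <-] := @continuous_FTC1_closed _ g (-2) x (x + 1)
  (ltr_pwDr ltr01 (lexx x)) (@continuous_integrable g _ _ cg) x1 (cg x).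
by rewrite derive1E; apply: DeriveDef.
Qed.

Lemma derive_continuous_at G (x d : R) : is_derive x 1 G d ->
  {for x, continuous G}.
Proof.
by move=> [dG _]; apply/differentiable_continuous/derivable1_diffP.
Qed.

Lemma within_continuous_primitive G g (a b : R) : -1 < a ->
  (forall x : R, -1 < x -> is_derive x 1 G (g x)) ->
  {within `[a, b], continuous G}.
Proof.
move=> a1 dG; apply: continuous_in_subspaceT => x.
rewrite inE/= in_itv/= => /andP[ax _].
exact: derive_continuous_at (dG x (lt_le_trans a1 ax)).
Qed.

Lemma mean_primitive g G : continuous g ->
  (forall x : R, -1 < x -> is_derive x 1 G (g x)) ->
  mean g = (2 * pi)^-1 * (G (2 * pi) - G 0).
Proof.
move=> cg dG; have N0 x : 0 <= x -> -1 < x :> R by apply: lt_le_trans; rewrite ltrN10.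
rewrite /mean /Rintegral (@continuous_FTC2 _ g G)//.
- exact: twopi_gt0.
- exact: continuous_subspaceT.
- split.
  + move=> x; rewrite in_itv/= => /andP[x0 _].
    by have [] := dG x (N0 _ (ltW x0)).
  + apply: cvg_at_right_filter.
    by apply: derive_continuous_at; apply: dG; exact: N0.
  + apply: cvg_at_left_filter.
    by apply: derive_continuous_at; apply: dG; apply/N0/ltW/twopi_gt0.
- move=> x; rewrite in_itv/= => /andP[x0 _].
  by have [d1 d2] := dG x (N0 _ (ltW x0)); rewrite derive1E.
Qed.

Lemma is_derive_translate (x a : R) : is_derive x 1 (fun y : R => y + a) 1.
Proof.
rewrite -[X in is_derive _ _ _ X]addr0.
exact: (is_deriveD (is_derive_id x 1) (is_derive_cst a x 1)).
Qed.

Lemma is_derive_scale (x c : R) : is_derive x 1 (fun y : R => c * y) c.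
Proof.
by have := is_deriveZ c (is_derive_id x 1); rewrite /GRing.scale/= mulr1.
Qed.

Lemma is_derive_comp_translate G (x a d : R) : is_derive (x + a) 1 G d ->
  is_derive x 1 (fun y : R => G (y + a)) d.
Proof.
move=> dG; have := @is_derive1_comp _ G (fun y => y + a) x _ _ dG
  (is_derive_translate x a).
by rewrite mulr1.
Qed.

(** The left-hand side has derivative [g (x + 2 * pi) - g x = 0]. *)
Lemma primitive_period g G : continuous g ->
  (forall t, g (t + 2 * pi) = g t) ->
  (forall x : R, -1 < x -> is_derive x 1 G (g x)) ->
  forall x, 0 < x -> G (x + 2 * pi) - G x = G (2 * pi) - G 0.
Proof.
move=> cg gp dG x x0.
pose K y := G (y + 2 * pi) - G y.
have dK (y : R) : -1 < y -> is_derive y 1 K (g (y + 2 * pi) - g y).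
  move=> y1; apply: is_deriveB; last exact: dG.
  have y2 : -1 < y + 2 * pi by rewrite (lt_trans y1)// ltrDl twopi_gt0.
  have dGy := dG _ y2.
  exact: is_derive_comp_translate.
have dK0 y : y \in `]0, x[ -> is_derive y 1 K (g (y + 2 * pi) - g y).
  by rewrite in_itv/= => /andP[y0 _]; apply/dK/(lt_trans (ltrN10 _)).
have cK : {within `[0, x], continuous K}.
  by apply: within_continuous_primitive dK; exact: ltrN10.
have [y _] := MVT x0 dK0 cK.
rewrite gp subrr mul0r => /eqP; rewrite subr_eq0 => /eqP.
by rewrite /K add0r.
Qed.

Lemma mean_shift g : continuous g -> (forall t, g (t + 2 * pi) = g t) ->
  mean (fun t => g (t + pi)) = mean g.
Proof.
move=> cg gp; have [G dG2] := primitive cg.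
have dG (x : R) : -1 < x -> is_derive x 1 G (g x) by move=> x1; apply: dG2; lra.
rewrite (mean_primitive cg dG).
have cg' : continuous (fun t : R => g (t + pi)).
  move=> t; apply: continuous_comp; last exact: cg.
  exact: derive_continuous_at (is_derive_translate t pi).
have dG' (x : R) : -1 < x -> is_derive x 1 (fun t => G (t + pi)) (g (x + pi)).
  move=> x1; have x2 : -1 < x + pi by rewrite (lt_trans x1)// ltrDl pi_gt0.
  have dGy := dG _ x2.
  exact: is_derive_comp_translate.
rewrite (mean_primitive cg' dG') add0r [2 * pi + pi]addrC.
by rewrite (primitive_period cg gp dG) ?pi_gt0.
Qed.

Lemma mean_double g : continuous g -> (forall t, g (t + 2 * pi) = g t) ->
  mean (fun t => g (2 * t)) = mean g.
Proof.
move=> cg gp; have [G dG2] := primitive cg.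
have dG (x : R) : -1 < x -> is_derive x 1 G (g x) by move=> x1; apply: dG2; lra.
have cg' : continuous (fun t : R => g (2 * t)).
  move=> t; apply: continuous_comp; last exact: cg.
  exact: derive_continuous_at (is_derive_scale t 2).
rewrite (mean_primitive cg dG).
have dG' (x : R) : -1 < x -> is_derive x 1 (fun t => 2^-1 * G (2 * t)) (g (2 * x)).
  move=> x1; have x2 : -2 < 2 * x by lra.
  have dGy := dG2 _ x2.
  have dG' := @is_derive1_comp _ G (fun y => 2 * y) x _ _ dGy (is_derive_scale x 2).
  have := is_deriveZ 2^-1 dG'.
  by rewrite /GRing.scale/= mulrCA mulVf// mulr1.
have p4 := primitive_period cg gp dG (twopi_gt0).
rewrite (mean_primitive cg' dG') mulr0 -mulrBr; congr (_ * _).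
rewrite [2 * (2 * pi)](_ : _ = 2 * pi + 2 * pi); last by rewrite mulr_natl mulr2n.
lra.
Qed.

(** The primitive of the nonnegative function [c - g] is nondecreasing and takes
    equal values at both ends of the period, so it is constant. On a circle the
    interior point [pi] of the period is opposite to the starting point. *)
Lemma mean_ge_max_eq g c : continuous g -> (forall t, g t <= c) -> c <= mean g ->
  g pi = c.
Proof.
move=> cg gc cm; have [G dG2] := primitive cg.
have dG (x : R) : -1 < x -> is_derive x 1 G (g x) by move=> x1; apply: dG2; lra.
pose K y := c * y - G y.
have dK (y : R) : -1 < y -> is_derive y 1 K (c - g y).
  move=> y1; apply: is_deriveB; last exact: dG.
  exact: is_derive_scale.
have ndK : forall x y, 0 <= x -> x <= y -> y <= 2 * pi -> K x <= K y.
  apply: ger0_derive1_ndecr.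
  - move=> x; rewrite in_itv/= => /andP[x0 _].
    by have [] := dK x (lt_trans (ltrN10 _) x0).
  - move=> x; rewrite in_itv/= => /andP[x0 _].
    have [d1 d2] := dK x (lt_trans (ltrN10 _) x0).
    by rewrite derive1E d2 subr_ge0.
  - by apply: within_continuous_primitive dK; exact: ltrN10.
have K02 : K (2 * pi) <= K 0.
  move: cm; rewrite (mean_primitive cg dG) mulrC ler_pdivlMr ?twopi_gt0//.
  by rewrite /K; lra.
have Kcst y : 0 <= y -> y <= 2 * pi -> K y = K 0.
  move=> y0 y2; apply: le_anti.
  by rewrite (ndK 0 y)// andbT (le_trans _ K02)// ndK.
have pi0 := pi_gt0 R.
have [d1 d2] := dK pi (lt_trans (ltrN10 _) pi0).
have KE : \forall y \near (pi : R), cst (K 0) y = K y.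
  near=> y; rewrite /= Kcst// ltW//; near: y.
    exact: lt_nbhsr.
  by apply: lt_nbhsl; lra.
have := @near_eq_derive _ R R _ _ _ 1 KE.
by rewrite derive_cst d2 => /esym/eqP; rewrite subr_eq0 => /eqP.
Unshelve. all: by end_near. Qed.

(** The graph of [expR] lies above its tangent at the mean [m] of [g], and the
    tangent, evaluated along [g], has mean [expR m]. *)
Lemma jensen_exp g : continuous g -> expR (mean g) <= mean (fun t => expR (g t)).
Proof.
move=> cg; set m := mean g.
have ce : continuous (fun t => expR (g t)).
  by move=> t; apply: continuous_comp; [exact: cg|exact: continuous_expR].
have cl : continuous (fun t => expR m * (1 - m) + expR m * g t).
  move=> t; apply: cvgD; first exact: cvg_cst.
  by apply: cvgM; [exact: cvg_cst|exact: cg].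
have <- : mean (fun t => expR m * (1 - m) + expR m * g t) = expR m.
  rewrite meanD; [|by move=> ?; exact: cvg_cst|by move=> t; apply: cvgM; [exact: cvg_cst|exact: cg]].
  by rewrite mean_cst meanZ// -/m; ring.
apply: mean_le => // t.
have -> : expR (g t) = expR m * expR (g t - m) by rewrite -expRD addrC subrK.
rewrite -mulrDr ler_pM2l ?expR_gt0// (le_trans _ (expR_ge1Dx _))//; lra.
Qed.

End Mean.

(** * Means of logarithms of trigonometric polynomials *)

Section LogMean.
Variable R : realType.
Implicit Types (a b c x y r t A D e p m : R).

Definition trig a b c t : R := a + (b * cos t - c * sin t).

Lemma continuous_trig a b c : continuous (trig a b c).
Proof.
move=> t; apply: cvgD; first exact: cvg_cst.
apply: cvgB; apply: cvgM; try exact: cvg_cst.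
- exact: continuous_cos.
- exact: continuous_sin.
Qed.

Lemma trig_shift a b c t : trig a b c (t + pi) = trig a (- b) (- c) t.
Proof. by rewrite /trig cosDpi sinDpi !mulrN !mulNr. Qed.

Lemma trig_period a b c t : trig a b c (t + 2 * pi) = trig a b c t.
Proof. by rewrite /trig (mulr_natl pi) cosD2pi sinD2pi. Qed.

(** The shift by [pi] changes the sign of the trigonometric part. *)
Lemma mean_trig a b c : mean (trig a b c) = a.
Proof.
have ct := @continuous_trig a b c.
have ct' := @continuous_trig a (- b) (- c).
have := mean_shift ct (trig_period a b c).
rewrite (eq_mean (trig_shift a b c)) => E.
have : mean (fun t => trig a (- b) (- c) t + trig a b c t) = a + a.
  rewrite -[RHS]mean_cst; apply: eq_mean => t; rewrite /trig; lra.
by rewrite meanD// E; lra.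
Qed.

Lemma trig_sqr_le x y t : (x * cos t - y * sin t) ^+ 2 <= x ^+ 2 + y ^+ 2.
Proof.
have := cos2Dsin2 t; have := sqr_ge0 (x * sin t + y * cos t); nra.
Qed.

Lemma trig_ge x y r t : 0 <= r -> x ^+ 2 + y ^+ 2 <= r ^+ 2 ->
  - r <= x * cos t - y * sin t <= r.
Proof.
move=> r0 xyr; rewrite -ler_norml -ler_sqr ?nnegrE// real_normK ?num_real//.
exact: le_trans (trig_sqr_le _ _ _) xyr.
Qed.

(** The squared modulus of [1 + s e^(it)] for [s = x + iy]. *)
Definition onep x y := trig (1 + (x ^+ 2 + y ^+ 2)) (2 * x) (2 * y).

Lemma onep_bounds x y r t : 0 <= r < 1 -> x ^+ 2 + y ^+ 2 <= r ^+ 2 ->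
  (1 - r) ^+ 2 <= onep x y t <= 4.
Proof.
move=> /andP[r0 r1] xyr; have /andP[l u] := trig_ge t r0 xyr.
have := trig_sqr_le x y t; rewrite /onep /trig.
set v := x * cos t - y * sin t in l u *.
have -> : 2 * x * cos t - 2 * y * sin t = 2 * v by rewrite /v; ring.
by move=> vq; apply/andP; split; nra.
Qed.

Lemma onep_gt0 x y t : x ^+ 2 + y ^+ 2 < 1 -> 0 < onep x y t.
Proof.
move=> xy1; have := trig_sqr_le x y t; rewrite /onep /trig.
set v := x * cos t - y * sin t.
have -> : 2 * x * cos t - 2 * y * sin t = 2 * v by rewrite /v; ring.
by move=> vq; nra.
Qed.

Lemma onepM x y t : onep x y t * onep (- x) (- y) t =
  onep (y ^+ 2 - x ^+ 2) (- (2 * x * y)) (2 * t).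
Proof.
rewrite /onep /trig (mulr_natl t) cos_mulr2n sin_mulr2n.
have E := cos2Dsin2 t.
have -> : cos t ^+ 2 *+ 2 - 1 = cos t ^+ 2 - sin t ^+ 2 by lra.
rewrite -mulr_natl.
set C := cos t in E *; set S := sin t in E *.
apply/eqP; rewrite -subr_eq0; apply/eqP.
transitivity (2 * (x ^+ 2 + y ^+ 2) * (1 - (C ^+ 2 + S ^+ 2))); first by ring.
by rewrite E subrr mulr0.
Qed.

Lemma continuous_ln_trig a b c : (forall t, 0 < trig a b c t) ->
  continuous (fun t => ln (trig a b c t)).
Proof.
move=> tr0 t; apply: continuous_comp; first exact: continuous_trig.
exact: continuous_ln.
Qed.

Lemma continuous_onep x y : x ^+ 2 + y ^+ 2 < 1 ->
  continuous (fun t => ln (onep x y t)).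
Proof. by move=> xy1; apply: continuous_ln_trig => t; exact: onep_gt0. Qed.

Lemma mean_ln_onepN x y : x ^+ 2 + y ^+ 2 < 1 ->
  mean (fun t => ln (onep (- x) (- y) t)) = mean (fun t => ln (onep x y t)).
Proof.
move=> xy1; rewrite -(mean_shift (continuous_onep xy1)); last first.
  by move=> t; rewrite /onep trig_period.
by apply: eq_mean => t; rewrite /onep trig_shift !sqrrN !mulrN.
Qed.

Lemma mean_ln_onep_double x y : x ^+ 2 + y ^+ 2 < 1 ->
  2 * mean (fun t => ln (onep x y t)) =
  mean (fun t => ln (onep (y ^+ 2 - x ^+ 2) (- (2 * x * y)) t)).
Proof.
move=> xy1; have xy1' : (- x) ^+ 2 + (- y) ^+ 2 < 1 by rewrite !sqrrN.
have z1 : (y ^+ 2 - x ^+ 2) ^+ 2 + (- (2 * x * y)) ^+ 2 < 1.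
  by have := sqr_ge0 x; have := sqr_ge0 y; nra.
rewrite -(mean_double (continuous_onep z1)); last first.
  by move=> t; rewrite /onep trig_period.
under [RHS]eq_mean do rewrite -onepM lnM ?posrE ?onep_gt0//.
by rewrite (meanD (continuous_onep xy1) (continuous_onep xy1')) mean_ln_onepN//; lra.
Qed.

(** The mean value property of [ln |1 + s e^(it)|^2]. The mean [I(s)] satisfies
    [2 I(s) = I(s) + I(-s) = I(-s^2)], since the product of [1 + s e^(it)] and
    [1 - s e^(it)] is [1 - s^2 e^(2it)]; as [I] is bounded on discs, iterating
    shows that it vanishes. *)
Lemma mean_ln_onep x y : x ^+ 2 + y ^+ 2 < 1 ->
  mean (fun t => ln (onep x y t)) = 0.
Proof.
move=> xy1.
pose r : R := Num.sqrt (x ^+ 2 + y ^+ 2).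
have r0 : 0 <= r by exact: sqrtr_ge0.
have xyr : x ^+ 2 + y ^+ 2 <= r ^+ 2 by rewrite sqr_sqrtr// addr_ge0 ?sqr_ge0.
have r1 : r < 1 by rewrite -(@ltr_sqr _ r 1) ?nnegrE// expr1n sqr_sqrtr// addr_ge0 ?sqr_ge0.
have r01 : 0 <= r < 1 by rewrite r0.
pose B : R := `|ln ((1 - r) ^+ 2)| + ln 4.
have lnB u : (1 - r) ^+ 2 <= u <= 4 -> `|ln u| <= B.
  move=> /andP[u1 u4].
  have p1 : 0 < (1 - r) ^+ 2 by rewrite exprn_gt0// subr_gt0.
  have u0 : 0 < u by exact: lt_le_trans u1.
  have l1 : ln ((1 - r) ^+ 2) <= ln u by rewrite ler_ln.
  have l4 : ln u <= ln 4 by rewrite ler_ln ?posrE.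
  have l40 : 0 <= ln (4 : R) by apply: ln_ge0; lra.
  have := ler_norm (- ln ((1 - r) ^+ 2)); rewrite normrN ler_norml /B => ?.
  by have := normr_ge0 (ln ((1 - r) ^+ 2)) => ?; apply/andP; split; lra.
have bound k : forall u v, u ^+ 2 + v ^+ 2 <= r ^+ 2 ->
    `|mean (fun t => ln (onep u v t))| * 2 ^+ k <= B.
  elim: k => [|k IH] u v uv.
    have uv1 : u ^+ 2 + v ^+ 2 < 1 by apply: le_lt_trans uv _; nra.
    have cu := continuous_onep uv1.
    have H t : - B <= ln (onep u v t) <= B.
      by rewrite -ler_norml; apply/lnB/onep_bounds.
    rewrite expr0 mulr1 ler_norml.
    by apply/andP; split; [apply: mean_ge_cst|apply: mean_le_cst] => // t;
      have /andP[] := H t.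
  have uv1 : u ^+ 2 + v ^+ 2 < 1 by apply: le_lt_trans uv _; nra.
  rewrite exprS mulrA [_ * 2]mulrC -[X in X * `|_|]ger0_norm// -normrM.
  rewrite mean_ln_onep_double//; apply: IH.
  by have := sqr_ge0 u; have := sqr_ge0 v; nra.
apply/eqP; rewrite -normr_le0 leNgt; apply/negP => I0.
(* After [k] doublings the mean has grown by [2^k], past the bound [B]. *)
pose k := Num.bound (B / `|mean (fun t => ln (onep x y t))|).
have Bk : B < `|mean (fun t => ln (onep x y t))| * k%:R.
  rewrite mulrC -ltr_pdivrMr// archi_boundP// divr_ge0// /B addr_ge0//.
  by apply: ln_ge0; lra.
have le2k : (k%:R : R) <= 2 ^+ k.
  by rewrite -[2 ^+ k]natrX ler_nat; apply: ltnW; exact: ltn_expl.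
have := bound k x y xyr; rewrite leNgt => /negP; apply.
exact: lt_le_trans Bk (ler_wpM2l (normr_ge0 _) le2k).
Qed.

(** Solving [X + A D / X = A + D + e] for the larger root [X] rewrites the
    integrand as [X |1 + s e^(it)|^2] with [|s| < 1]. *)
Lemma mean_ln_ge A D e p m : 0 <= A -> 0 <= D -> 0 < e ->
  p ^+ 2 + m ^+ 2 = A * D ->
  ln (A + e) <= mean (fun t => ln (trig (A + D + e) (2 * p) (2 * m) t)).
Proof.
move=> A0 D0 e0 pm.
set P := A + D + e.
have disc : 0 < P ^+ 2 - 4 * (A * D).
  rewrite (_ : _ - _ = (A - D) ^+ 2 + e * (e + 2 * (A + D))); last by rewrite /P; ring.
  by rewrite ltr_wpDl ?sqr_ge0// mulr_gt0// ltr_pwDl// mulr_ge0// addr_ge0.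
(* [X] is a root of [X^2 - P X + A D]; it satisfies [X >= A + e > 0]. *)
pose X : R := (P + Num.sqrt (P ^+ 2 - 4 * (A * D))) / 2.
have s0 : 0 < Num.sqrt (P ^+ 2 - 4 * (A * D)) by rewrite sqrtr_gt0.
have s2 : Num.sqrt (P ^+ 2 - 4 * (A * D)) ^+ 2 = P ^+ 2 - 4 * (A * D).
  exact/sqr_sqrtr/ltW.
set w := Num.sqrt _ in X s0 s2.
have XA : A + e <= X.
  have [h|h] := leP (A + e - D) 0; first by rewrite /X /P; lra.
  have : (A + e - D) ^+ 2 <= w ^+ 2 by rewrite s2 /P; nra.
  by rewrite ler_sqr ?nnegrE ?(ltW h)// /X /P; lra.
have X0 : 0 < X by apply: lt_le_trans XA; lra.
have XX : X ^+ 2 = P * X - A * D by rewrite /X; nra.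
have P2X : 0 < 2 * X - P by rewrite /X; lra.
clearbody X.
have q1 : (p / X) ^+ 2 + (m / X) ^+ 2 < 1.
  have X2 : 0 < X ^+ 2 by rewrite exprn_gt0.
  have : 0 < X * (2 * X - P) by rewrite mulr_gt0.
  by rewrite !expr_div_n -mulrDl pm (ltr_pdivrMr _ _ X2) mul1r; lra.
have E t : trig P (2 * p) (2 * m) t = X * onep (p / X) (m / X) t.
  rewrite /onep /trig !expr_div_n -mulrDl pm.
  have -> : P = X + A * D / X.
    apply: (mulIf (lt0r_neq0 X0)).
    transitivity (X ^+ 2 + A * D); first by rewrite XX; ring.
    by field; exact: lt0r_neq0.
  by field; exact: lt0r_neq0.
have L t : ln (trig P (2 * p) (2 * m) t) = ln X + ln (onep (p / X) (m / X) t).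
  by rewrite E lnM ?posrE ?onep_gt0.
rewrite (eq_mean L) meanD ?mean_cst ?mean_ln_onep// ?addr0; last exact: continuous_onep.
- by rewrite ler_ln ?posrE//; lra.
- by move=> ?; exact: cvg_cst.
Qed.

Lemma mean_ln_eq A D p m : 0 < A -> 0 <= D < A -> p ^+ 2 + m ^+ 2 = A * D ->
  mean (fun t => ln (trig (A + D) (2 * p) (2 * m) t)) = ln A.
Proof.
move=> A0 /andP[D0 DA] pm.
have q1 : (p / A) ^+ 2 + (m / A) ^+ 2 < 1.
  by rewrite !expr_div_n -mulrDl pm ltr_pdivrMr ?exprn_gt0// mul1r; nra.
have E t : trig (A + D) (2 * p) (2 * m) t = A * onep (p / A) (m / A) t.
  rewrite /onep /trig !expr_div_n -mulrDl pm.
  by field; exact: lt0r_neq0.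
have L t : ln (trig (A + D) (2 * p) (2 * m) t) = ln A + ln (onep (p / A) (m / A) t).
  by rewrite E lnM ?posrE ?onep_gt0.
rewrite (eq_mean L) meanD ?mean_cst ?mean_ln_onep// ?addr0//; last exact: continuous_onep.
by move=> ?; exact: cvg_cst.
Qed.

End LogMean.

(** * The modulus and the topology of complex space *)

(** Pointwise continuity of real functions, in a form that unifies with
    explicit expressions. *)
Section ContinuityAt.
Variables (R : realType) (T : topologicalType).
Implicit Types (f g : T -> R) (x : T).

Lemma cont_cst x (c : R) : {for x, continuous (fun _ : T => c)}.
Proof. exact: cvg_cst. Qed.

Lemma contD f g x : {for x, continuous f} -> {for x, continuous g} ->
  {for x, continuous (fun y => f y + g y)}.
Proof. exact: cvgD. Qed.

Lemma contB f g x : {for x, continuous f} -> {for x, continuous g} ->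
  {for x, continuous (fun y => f y - g y)}.
Proof. exact: cvgB. Qed.

Lemma contM f g x : {for x, continuous f} -> {for x, continuous g} ->
  {for x, continuous (fun y => f y * g y)}.
Proof. exact: cvgM. Qed.

Lemma contX f k x : {for x, continuous f} ->
  {for x, continuous (fun y => f y ^+ k)}.
Proof.
move=> cf; elim: k => [|k IH]; first exact: cont_cst.
rewrite (_ : (fun y => _) = (fun y => f y * f y ^+ k)); first exact: contM.
by apply/funext => y; rewrite exprS.
Qed.

Lemma cont_sum (I : Type) (r : seq I) (P : pred I) (F : I -> T -> R) x :
  (forall i, {for x, continuous (F i)}) ->
  {for x, continuous (fun y => \sum_(i <- r | P i) F i y)}.
Proof.
move=> cF; elim: r => [|i r IH].
  by rewrite (_ : (fun y => _) = (fun=> 0)); [exact: cont_cst|apply/funext => y; rewrite big_nil].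
rewrite (_ : (fun y => _) =
  (fun y => (if P i then F i y else 0) + \sum_(j <- r | P j) F j y)).
  by apply: contD => //; case: (P i) => //; exact: cont_cst.
by apply/funext => y; rewrite big_cons; case: (P i); rewrite ?add0r.
Qed.

Lemma cont_expR f x : {for x, continuous f} ->
  {for x, continuous (fun y => expR (f y))}.
Proof. by move=> cf; apply: (continuous_comp cf); exact: continuous_expR. Qed.

Lemma cont_ln f x : 0 < f x -> {for x, continuous f} ->
  {for x, continuous (fun y => ln (f y))}.
Proof. by move=> f0 cf; apply: (continuous_comp cf); exact: continuous_ln. Qed.

End ContinuityAt.

Section Sqmod.
Variable R : realType.
Implicit Types (z w : R[i]) (t r e : R).

Definition sqmod z : R := Re z ^+ 2 + Im z ^+ 2.
Definition cis t : R[i] := cos t +i* sin t.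

Lemma complex_ReD z w : Re (z + w) = Re z + Re w. Proof. by case: z; case: w. Qed.
Lemma complex_ImD z w : Im (z + w) = Im z + Im w. Proof. by case: z; case: w. Qed.
Lemma complex_ReN z : Re (- z) = - Re z. Proof. by case: z. Qed.
Lemma complex_ImN z : Im (- z) = - Im z. Proof. by case: z. Qed.
Lemma complex_ReM z w : Re (z * w) = Re z * Re w - Im z * Im w.
Proof. by case: z; case: w. Qed.
Lemma complex_ImM z w : Im (z * w) = Re z * Im w + Im z * Re w.
Proof. by case: z; case: w. Qed.

Lemma sqmod_ge0 z : 0 <= sqmod z.
Proof. by rewrite addr_ge0 ?sqr_ge0. Qed.

Lemma sqmod_eq0 z : (sqmod z == 0) = (z == 0).
Proof.
by case: z => a b; rewrite /sqmod paddr_eq0 ?sqr_ge0//= !sqrf_eq0 eq_complex.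
Qed.

Lemma sqmodM z w : sqmod (z * w) = sqmod z * sqmod w.
Proof. rewrite /sqmod complex_ReM complex_ImM; ring. Qed.

Lemma sqmodN z : sqmod (- z) = sqmod z.
Proof. by rewrite /sqmod complex_ReN complex_ImN !sqrrN. Qed.

Lemma sqmod_real r : sqmod r%:C = r ^+ 2.
Proof. by rewrite /sqmod/= expr0n addr0. Qed.

Lemma sqmod_cis t : sqmod (cis t) = 1.
Proof. exact: cos2Dsin2. Qed.

Lemma sqmodD_le z w : sqmod (z + w) <= 2 * sqmod z + 2 * sqmod w.
Proof.
rewrite /sqmod complex_ReD complex_ImD.
have := sqr_ge0 (Re z - Re w); have := sqr_ge0 (Im z - Im w); nra.
Qed.

Lemma sqmod_norm z r : 0 <= r -> (`|z| <= r%:C) = (sqmod z <= r ^+ 2).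
Proof.
move=> r0; rewrite normc_def lecR -[RHS]ler_sqrt ?sqr_ge0//.
by rewrite [X in _ = (_ <= X)]sqrtr_sqr ger0_norm.
Qed.

Lemma sqmod_norm_lt z r : 0 < r -> (`|z| < r%:C) = (sqmod z < r ^+ 2).
Proof.
move=> r0; rewrite normc_def ltcR -[RHS]ltr_sqrt ?exprn_gt0//.
by rewrite [X in _ = (_ < X)]sqrtr_sqr gtr0_norm.
Qed.

(** Along a circle the squared modulus is a trigonometric polynomial. *)
Lemma sqmod_circle z w t :
  sqmod (z + w * cis t) = trig (sqmod z + sqmod w)
    (2 * (Re z * Re w + Im z * Im w)) (2 * (Re z * Im w - Im z * Re w)) t.
Proof.
have E := cos2Dsin2 t.
rewrite /trig /sqmod complex_ReD complex_ImD complex_ReM complex_ImM /=.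
apply/eqP; rewrite -subr_eq0; apply/eqP.
transitivity ((Re w ^+ 2 + Im w ^+ 2) * (cos t ^+ 2 + sin t ^+ 2 - 1)).
  ring.
by rewrite E subrr mulr0.
Qed.

(** The form in which the coefficients of [sqmod_circle] meet the hypothesis of
    [mean_ln_ge] and [mean_ln_eq]. *)
Lemma sqmod_cross z w : (Re z * Re w + Im z * Im w) ^+ 2 +
  (Re z * Im w - Im z * Re w) ^+ 2 = sqmod z * sqmod w.
Proof. rewrite /sqmod; ring. Qed.

Lemma mean_sqmod z w : mean (fun t => sqmod (z + w * cis t)) = sqmod z + sqmod w.
Proof. by rewrite (eq_mean (sqmod_circle z w)) mean_trig. Qed.

Lemma mean_ln_sqmod_ge z w e : 0 < e ->
  ln (sqmod z + e) <= mean (fun t => ln (sqmod (z + w * cis t) + e)).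
Proof.
move=> e0; apply: le_trans (mean_ln_ge (sqmod_ge0 z) (sqmod_ge0 w) e0 (sqmod_cross z w)) _.
rewrite le_eqVlt; apply/orP; left; apply/eqP/eq_mean => t.
by rewrite sqmod_circle /trig addrAC.
Qed.

Lemma mean_ln_sqmod z w : sqmod w < sqmod z ->
  mean (fun t => ln (sqmod (z + w * cis t))) = ln (sqmod z).
Proof.
move=> wz; rewrite -(@mean_ln_eq _ (sqmod z) (sqmod w) _ _ _ _ (sqmod_cross z w)).
- by apply: eq_mean => t; rewrite sqmod_circle.
- by rewrite (le_lt_trans _ wz) ?sqmod_ge0.
- by rewrite sqmod_ge0.
Qed.

Lemma circle_antipodal t : cis (t + pi) = - cis t :> R[i].
Proof. by rewrite /cis cosDpi sinDpi. Qed.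

Lemma cis_period t : cis (t + 2 * pi) = cis t.
Proof. by rewrite /cis (mulr_natl pi) cosD2pi sinD2pi. Qed.

Lemma cis_pi : cis pi = -1.
Proof. by rewrite /cis cospi sinpi; apply/eqP; rewrite eq_complex/= oppr0 !eqxx. Qed.

Lemma cis_surj z : sqmod z = 1 -> exists t, z = cis t.
Proof.
case: z => a b; rewrite /sqmod/= => ab1.
have a1 : -1 <= a <= 1 by have := sqr_ge0 b => ?; apply/andP; split; nra.
have sE : Num.sqrt (1 - a ^+ 2) = `|b|.
  by rewrite -ab1 addrAC subrr add0r sqrtr_sqr.
have [b0|b0] := leP 0 b.
  by exists (acos a); rewrite /cis acosK ?in_itv//= sin_acos// sE ger0_norm.
exists (- acos a); rewrite /cis cosN sinN acosK ?in_itv//= sin_acos// sE.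
by rewrite ltr0_norm// opprK.
Qed.

End Sqmod.

Section Topology.
Variable R : realType.
Local Notation C := (R[i]^o).

Lemma near_sqmod (z : C) (P : C -> Prop) :
  (\forall w \near z, P w) <->
  exists e : R, 0 < e /\ forall w, sqmod (w - z) < e ^+ 2 -> P w.
Proof.
split.
  move=> /nbhs_ballP[e /= e0 zP].
  have [re E] : exists re : R, e = re%:C.
    by exists (Re e); case: e e0 {zP} => a b; rewrite ltcE/= => /andP[/eqP -> _].
  have re0 : 0 < re by move: e0; rewrite E ltcR.
  exists re; split => // w wz; apply: zP.
  by rewrite -ball_normE/= -[z - w]opprB normrN E sqmod_norm_lt.
move=> [e [e0 zP]]; apply/nbhs_ballP; exists e%:C; first by rewrite /= ltcR.
move=> w; rewrite -ball_normE/= -[z - w]opprB normrN sqmod_norm_lt//.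
exact: zP.
Qed.

Lemma continuous_sqmodP (f : C -> R) (z : C) :
  (forall e : R, 0 < e -> exists d : R, 0 < d /\
     forall w, sqmod (w - z) < d ^+ 2 -> `|f z - f w| < e) ->
  {for z, continuous f}.
Proof.
move=> H; apply/(@cvgrPdist_lt R R C (nbhs z) _ f (f z)) => e e0.
apply/near_sqmod.
exact: H.
Qed.

Lemma continuous_Re : continuous (fun z : C => Re z).
Proof.
move=> z; apply: continuous_sqmodP => e e0; exists e; split => // w.
rewrite /sqmod complex_ReD complex_ReN complex_ImD complex_ImN => H.
rewrite -(@ltr_sqr _ `|_|) ?nnegrE ?(ltW e0)// real_normK ?num_real//.
by have := sqr_ge0 (Im w - Im z); nra.
Qed.

Lemma continuous_Im : continuous (fun z : C => Im z).
Proof.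
move=> z; apply: continuous_sqmodP => e e0; exists e; split => // w.
rewrite /sqmod complex_ReD complex_ReN complex_ImD complex_ImN => H.
rewrite -(@ltr_sqr _ `|_|) ?nnegrE ?(ltW e0)// real_normK ?num_real//.
by have := sqr_ge0 (Re w - Re z); nra.
Qed.

Lemma continuous_Complex (T : topologicalType) (f g : T -> R) x :
  {for x, continuous f} -> {for x, continuous g} ->
  {for x, continuous (fun y => f y +i* g y : C)}.
Proof.
move=> cf cg A /near_sqmod[e [e0 eA]].
have e2 : 0 < e / 2 by rewrite divr_gt0.
have /(@cvgrPdist_lt R R) /(_ _ e2) nf := cf.
have /(@cvgrPdist_lt R R) /(_ _ e2) ng := cg.
change (\forall y \near x, A (f y +i* g y)).
near=> y; apply: eA; rewrite /sqmod complex_ReD complex_ImD complex_ReN complex_ImN /=.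
have /ltr_normlP[f1 f2] : `|f x - f y| < e / 2 by near: y; exact: nf.
have /ltr_normlP[g1 g2] : `|g x - g y| < e / 2 by near: y; exact: ng.
nra.
Unshelve. all: by end_near. Qed.

Lemma continuous_cis : continuous (fun t : R => cis t : C).
Proof.
by move=> t; apply: continuous_Complex; [exact: continuous_cos|exact: continuous_sin].
Qed.

Lemma continuous_sqmod : continuous (fun z : C => sqmod z).
Proof.
move=> z; have c1 := contX (k := 2) (@continuous_Re z).
exact: contD c1 (contX (k := 2) (@continuous_Im z)).
Qed.

Lemma continuous_affine n (T : topologicalType) (g : T -> C) x (a b : 'CC[R]_n) :
  {for x, continuous g} -> {for x, continuous (fun y => a + g y *: b)}.
Proof. by move=> cg; exact: cvgD (cvg_cst a) (cvgZ cg (cvg_cst b)). Qed.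

Lemma compact_sqmod (M : R) : compact [set z : C | sqmod z <= M].
Proof.
pose B := `[- (M + 1), M + 1]%classic : set R.
have cB : compact (B `*` B) by apply: compact_setX; exact: segment_compact.
have cF : continuous (fun p : R * R => p.1 +i* p.2 : C).
  by move=> p; apply: continuous_Complex; [exact: cvg_fst|exact: cvg_snd].
apply: (subclosed_compact _ (continuous_compact (continuous_subspaceT cF) cB)).
  apply: (@preimage_closed _ _ (fun z : C => sqmod z) [set r | r <= M]).
    by move=> z _; exact: continuous_sqmod.
  exact: closed_le.
move=> [a b]; rewrite /sqmod/= => abM; exists (a, b) => //.
have := sqr_ge0 a; have := sqr_ge0 b => b2 a2.
by split; rewrite /B/= in_itv/=; apply/andP; split; nra.
Qed.

Definition sqnorm n (x : 'CC[R]_n) : R := \sum_i sqmod (x 0 i).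

Lemma continuous_coord_Re n (i : 'I_n) (x : 'CC[R]_n) :
  {for x, continuous (fun y : 'CC[R]_n => Re (y 0 i))}.
Proof. exact: continuous_comp (@coord_continuous _ _ _ 0 i x) (@continuous_Re _). Qed.

Lemma continuous_coord_Im n (i : 'I_n) (x : 'CC[R]_n) :
  {for x, continuous (fun y : 'CC[R]_n => Im (y 0 i))}.
Proof. exact: continuous_comp (@coord_continuous _ _ _ 0 i x) (@continuous_Im _). Qed.

Lemma continuous_coord_sqmod n (i : 'I_n) (x p : 'CC[R]_n) :
  {for x, continuous (fun y : 'CC[R]_n => sqmod (y 0 i - p 0 i))}.
Proof.
rewrite (_ : (fun y => _) = (fun y : 'CC[R]_n =>
    (Re (y 0 i) - Re (p 0 i)) ^+ 2 + (Im (y 0 i) - Im (p 0 i)) ^+ 2)).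
  have cR := contB (@continuous_coord_Re n i x) (@cont_cst _ _ x (Re (p 0 i))).
  have cI := contB (@continuous_coord_Im n i x) (@cont_cst _ _ x (Im (p 0 i))).
  exact: contD (contX (k := 2) cR) (contX (k := 2) cI).
by apply/funext => y; rewrite /sqmod complex_ReD complex_ImD complex_ReN complex_ImN.
Qed.

Lemma continuous_sqnorm n (x p : 'CC[R]_n) :
  {for x, continuous (fun y : 'CC[R]_n => sqnorm (y - p))}.
Proof.
rewrite (_ : (fun y => _) = (fun y : 'CC[R]_n => \sum_i sqmod (y 0 i - p 0 i))).
  by apply: cont_sum => i; exact: continuous_coord_sqmod.
by apply/funext => y; apply: eq_bigr => i _; rewrite !mxE.
Qed.

Lemma sqnorm_ge0 n (x : 'CC[R]_n) : 0 <= sqnorm x.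
Proof. by apply: sumr_ge0 => i _; exact: sqmod_ge0. Qed.

Lemma sqmod_le_sqnorm n (x : 'CC[R]_n) i : sqmod (x 0 i) <= sqnorm x.
Proof.
by rewrite /sqnorm (bigD1 i)//= lerDl sumr_ge0// => j _; exact: sqmod_ge0.
Qed.

Lemma sqnormZ n (z : R[i]) (x : 'CC[R]_n) : sqnorm (z *: x) = sqmod z * sqnorm x.
Proof.
by rewrite /sqnorm mulr_sumr; apply: eq_bigr => i _; rewrite mxE sqmodM.
Qed.

Lemma sqnormD_le n (x y : 'CC[R]_n) : sqnorm (x + y) <= 2 * sqnorm x + 2 * sqnorm y.
Proof.
rewrite /sqnorm !mulr_sumr -big_split/=; apply: ler_sum => i _.
by rewrite mxE; exact: sqmodD_le.
Qed.

Lemma sqnorm0 n : sqnorm (0 : 'CC[R]_n) = 0.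
Proof. by rewrite /sqnorm big1// => i _; rewrite mxE /sqmod/= expr0n addr0. Qed.

Lemma continuous_sqnorm0 n (x : 'CC[R]_n) : {for x, continuous (@sqnorm n)}.
Proof.
have := @continuous_sqnorm n x 0.
by rewrite (_ : (fun y => _) = @sqnorm n)//; apply/funext => y; rewrite subr0.
Qed.

(** The topology of [C^n] is that of the sup norm; this passes to the Euclidean
    norm, with which circle means are easier to compute. *)
Lemma near_sqnorm n (x : 'CC[R]_n) (P : 'CC[R]_n -> Prop) :
  (\forall y \near x, P y) <->
  exists e : R, 0 < e /\ forall y, sqnorm (y - x) < e -> P y.
Proof.
split.
  move=> /nbhs_ballP[e /= e0 zP].
  have [re E] : exists re : R, e = re%:C.
    by exists (Re e); case: e e0 {zP} => a b; rewrite ltcE/= => /andP[/eqP -> _].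
  have re0 : 0 < re by move: e0; rewrite E ltcR.
  exists (re ^+ 2); split; first by rewrite exprn_gt0.
  move=> y yx; apply: zP; split => // i j; rewrite (ord1 i).
  rewrite -ball_normE/= -[x 0 j - y 0 j]opprB normrN E sqmod_norm_lt//.
  by apply: le_lt_trans yx; have := sqmod_le_sqnorm (y - x) j; rewrite !mxE.
move=> [e [e0 zP]].
have := @continuous_sqnorm n x x; move/(@cvgrPdist_lt R R _ (nbhs x) _ _ _)/(_ _ e0).
apply: filterS => y; rewrite subrr sqnorm0.
by rewrite sub0r normrN ger0_norm ?sqnorm_ge0//; exact: zP.
Qed.

Lemma compact_sqnorm n (M : R) : compact [set x : 'CC[R]_n | sqnorm x <= M].
Proof.
pose K : 'I_n -> set C := fun=> [set z : C | sqmod z <= M]%classic.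
apply: (subclosed_compact _ (@rV_compact C n K (fun=> @compact_sqmod M))).
  apply: (@preimage_closed _ _ (@sqnorm n) [set r | r <= M]).
    by move=> x _; exact: continuous_sqnorm0.
  exact: closed_le.
by move=> x /= xM i; apply: le_trans xM; exact: sqmod_le_sqnorm.
Qed.

End Topology.

(** * Submean inequalities and plurisubharmonicity *)

Section MeanLimit.
Variable R : realType.

Lemma mean_sum (I : Type) (r : seq I) (P : pred I) (F : I -> R -> R) :
  (forall i, continuous (F i)) ->
  mean (fun t => \sum_(i <- r | P i) F i t) = \sum_(i <- r | P i) mean (F i).
Proof.
move=> cF; elim: r => [|i r IH].
  by rewrite big_nil -[RHS]mean_cst; apply: eq_mean => t; rewrite big_nil.
rewrite big_cons -IH; have cr : continuous (fun t => \sum_(j <- r | P j) F j t).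
  by move=> t; apply: cont_sum => j; exact: cF.
case: ifP => Pi; last by apply: eq_mean => t; rewrite big_cons Pi.
by rewrite -(meanD (cF i) cr); apply: eq_mean => t; rewrite big_cons Pi.
Qed.

(** Dominated convergence. The limit [v] need not be continuous, which is why the
    conclusion is about the extended integral and not about [mean]. *)
Lemma mean_limit_ge (u : nat -> R -> R) (v l : R -> R) (c : R) :
  (forall k, continuous (u k)) -> continuous l ->
  (forall t k, u k.+1 t <= u k t) -> (forall t k, l t <= u k t) ->
  (forall t, u ^~ t @ \oo --> v t) ->
  (forall k, c <= mean (u k)) ->
  (c%:E <= ((2 * pi)^-1)%:E *
    \int[lebesgue_measure]_(t in `[0%R, (2 * pi)%R]) (v t)%:E)%E.
Proof.
move=> cu cl dec low lim cm.
pose g t : R := `|u 0%N t| + `|l t|.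
have cg : continuous g.
  by move=> t; exact: cvgD (cvg_norm (cu 0%N t)) (cvg_norm (cl t)).
have ub k t : u k t <= u 0%N t.
  by elim: k => // k IH; exact: le_trans (dec t k) IH.
pose I : set R := `[0%R, (2 * pi)%R]%classic.
have mI : measurable I by exact: measurable_itv.
pose uE k (t : R) := (u k t)%:E.
pose vE (t : R) := (v t)%:E.
pose gE (t : R) := (g t)%:E.
have mu_ k : measurable_fun I (uE k).
  exact: measurable_int (continuous_integrable _ _ (cu k)).
have limE t : I t -> uE k t @[k --> \oo] --> vE t.
  by move=> _; apply: cvg_EFin; [exact: nearW|exact: lim].
have mv : measurable_fun I vE by exact: (emeasurable_fun_cvg _ _ mu_ limE).
have bnd t k : I t -> (`|uE k t| <= gE t)%E.
  move=> _; rewrite lee_fin; have := ub k t; have := low t k.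
  have := ler_norm (u 0%N t); have := ler_norm (- l t); rewrite normrN => *.
  rewrite ler_norml /g; have := normr_ge0 (u 0%N t); have := normr_ge0 (l t) => *.
  by apply/andP; split; lra.
have H : (\int[lebesgue_measure]_(t in I) uE k t @[k --> \oo] -->
    \int[lebesgue_measure]_(t in I) vE t)%E.
  have [||//] := @dominated_convergence _ _ _ lebesgue_measure _ mI
    uE vE gE mu_ mv _ (continuous_integrable _ _ cg) _; apply: aeW.
  - exact: limE.
  - by move=> t k; exact: bnd.
have {}H : ((mean (u k))%:E @[k --> \oo] -->
  ((2 * pi)^-1)%:E * \int[lebesgue_measure]_(t in I) vE t)%E.
  rewrite (_ : (fun k => _) = (fun k => ((2 * pi)^-1)%:E * \int[lebesgue_measure]_(t in I) uE k t))%E.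
    by apply: cvgeZl.
  by apply/funext => k; rewrite meanE.
apply: (cvge_to_ge H).
by apply: nearW => k; rewrite lee_fin.
Qed.

End MeanLimit.

Section Psh.
Variables (R : realType) (n : nat).
Local Notation CC := 'CC[R]_n.
Implicit Types (U : set CC) (x d : CC).

(** Absorbing the radius of a disc into its direction vector [d], every closed
    disc in a complex line becomes an affine image of the unit disc. *)
Definition disc_in U x d : Prop :=
  forall w : R[i], sqmod w <= 1 -> U (x + w *: d).

Lemma continuous_circle (f : CC -> R) x d :
  (forall t, {for x + cis t *: d, continuous f}) ->
  continuous (fun t : R => f (x + cis t *: d)).
Proof.
move=> cf t.
have c := @continuous_affine R n _ (@cis R) t x d (@continuous_cis R t).
exact: (continuous_comp c (cf t)).
Qed.

Lemma disc_circle U x d t : disc_in U x d -> U (x + cis t *: d).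
Proof. by apply; rewrite sqmod_cis. Qed.

Lemma disc_center U x d : disc_in U x d -> U x.
Proof.
by move=> /(_ 0); rewrite scale0r addr0; apply; rewrite /sqmod/= expr0n addr0.
Qed.

(** The inequality for the circle of radius [r] about [z] in the line
    [a + zeta *: b] is the normalised one for [a + z *: b] and [r *: b]. *)
Lemma psh_intro U (phi : CC -> \bar R) :
  (forall z, U z -> (phi z < +oo)%E) -> usc_on U phi ->
  (forall x d, disc_in U x d -> (phi x <= ((2 * pi)^-1)%:E *
     \int[lebesgue_measure]_(t in `[0%R, (2 * pi)%R]) phi (x + cis t *: d)%R)%E) ->
  psh U phi.
Proof.
move=> fin usc sub; split => // a b; split.
- by move=> z /= Uz; exact: fin.
- move=> z /= Uz c pc.
  have cz : {for z, continuous (fun z : R[i]^o => a + z *: b)}.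
    exact: continuous_affine.
  exact: (cz _ (usc _ Uz c pc)).
- move=> z r r0 zr.
  have E (w : R[i]) : a + (z + r%:C * w) *: b = (a + z *: b) + w *: (r%:C *: b).
    by rewrite scalerDl addrA scalerA [w * _]mulrC.
  have := sub (a + z *: b) (r%:C *: b).
  under eq_integral do rewrite -E; apply.
  move=> w w1; rewrite -E; apply: (zr (z + r%:C * w)) => /=.
  rewrite addrAC subrr add0r sqmod_norm ?(ltW r0)// sqmodM sqmod_real.
  by rewrite ler_piMr// sqr_ge0.
Qed.

Lemma psh_disc U (phi : CC -> \bar R) x d : psh U phi -> disc_in U x d ->
  (phi x <= ((2 * pi)^-1)%:E *
     \int[lebesgue_measure]_(t in `[0%R, (2 * pi)%R]) phi (x + cis t *: d)%R)%E.
Proof.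
move=> [_ _ /(_ x d)[_ _ /(_ 0 1 ltr01)]] sub xd.
rewrite scale0r addr0 in sub.
under eq_integral => t _ do rewrite -[cis t]mul1r -[1 * _]add0r.
apply: sub => w /=; rewrite subr0 => w1; apply: xd.
by have := sqmod_norm w ler01; rewrite w1 expr1n => <-.
Qed.

Definition sub_mean U (f : CC -> R) : Prop :=
  forall x d, disc_in U x d -> f x <= mean (fun t => f (x + cis t *: d)).

Lemma psh_continuous U (f : CC -> R) : (forall x, U x -> {for x, continuous f}) ->
  sub_mean U f -> psh U (EFin \o f).
Proof.
move=> cf sub; apply: psh_intro.
- by move=> z _; rewrite /= ltry.
- move=> z Uz c /=; rewrite lte_fin => fc.
  have := cf z Uz; move/(@cvgrPdist_lt R R _ (nbhs z) _ f (f z))/(_ (c - f z)).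
  rewrite subr_gt0 => /(_ fc); apply: filterS => w /ltr_normlP[h1 h2].
  by rewrite lte_fin; lra.
- move=> x d xd; rewrite meanE; first by rewrite lee_fin; exact: sub.
  by apply: continuous_circle => t; apply: cf; exact: disc_circle.
Qed.

Lemma continuous_real_fine U (phi : CC -> \bar R) : continuous_real_on U phi ->
  forall x, U x -> {for x, continuous (fun y => fine (phi y))} /\
    phi x = (fine (phi x))%:E.
Proof.
move=> cphi x Ux; have [fx cx] := cphi x Ux; split; last by rewrite fineK.
have h : phi @ x --> (fine (phi x))%:E by rewrite fineK//; exact: cx.
exact: fine_cvg h.
Qed.

Lemma sub_mean_fine U (phi : CC -> \bar R) : psh U phi ->
  continuous_real_on U phi -> sub_mean U (fun x => fine (phi x)).
Proof.
move=> pphi cphi x d xd.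
have cf := continuous_real_fine cphi.
have cc : continuous (fun t : R => fine (phi (x + cis t *: d))).
  apply: (@continuous_circle (fun y => fine (phi y))) => t.
  by have [] := cf _ (disc_circle t xd).
have := psh_disc pphi xd.
under eq_integral => t _ do rewrite (cf _ (disc_circle t xd)).2.
by rewrite meanE// (cf _ (disc_center xd)).2 lee_fin.
Qed.

End Psh.

(** * The maximum principle and Liouville's theorem *)

Section MaximumPrinciple.
Variable R : realType.
Local Notation C := (R[i]^o).

Lemma continuous_circle1 (u : C -> R) (z d : C) :
  (forall t, {for z + d * cis t, continuous u}) ->
  continuous (fun t : R => u (z + d * cis t)).
Proof.
move=> cu t.
have c : {for t, continuous (fun t : R => z + d * cis t : C)}.
  exact: cvgD (cvg_cst z) (cvgM (cvg_cst d) (@continuous_cis R t)).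
exact: (continuous_comp c (cu t)).
Qed.

(** Adding a small multiple of [|z|^2], whose circle means are strictly larger
    than its value at the centre, turns an interior maximum into a
    contradiction. *)
Lemma maximum_principle (K : set C) (B : C -> Prop) (u : C -> R) (M : R) :
  compact K -> (forall z, K z -> {for z, continuous u}) ->
  (forall z, K z -> B z -> u z <= M) ->
  (forall z, K z -> ~ B z -> exists d : C, [/\ d != 0,
     forall t, K (z + d * cis t) & u z <= mean (fun t => u (z + d * cis t))]) ->
  forall z, K z -> u z <= M.
Proof.
move=> cK cu uB uI z0 Kz0; rewrite leNgt; apply/negP => Mz0.
have K0 : (K !=set0)%classic by exists z0.
have ex_max (f : C -> R) : (forall z, K z -> {for z, continuous f}) ->
    exists2 p, K p & forall z, K z -> f z <= f p.
  move=> cf; have [p pK pmax] := compact_EVT_max K0 cK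
    (continuous_in_subspaceT (fun z (Kz : z \in K) => cf z (set_mem Kz))).
  by exists p; [exact: set_mem|move=> z Kz; apply: pmax; exact: mem_set].
have csq (z : C) : {for z, continuous (@sqmod R : C -> R)} by exact: continuous_sqmod.
have [s Ks smax] := ex_max (@sqmod R : C -> R) (fun z _ => csq z).
have S0 : 0 <= sqmod s by exact: sqmod_ge0.
(* [e] is so small that [e |z|^2] does not close the gap between [M] and [u z0]
   on [K], where [|z|^2 <= |s|^2]. *)
pose e : R := (u z0 - M) / (2 * (sqmod s + 1)).
have e0 : 0 < e by rewrite divr_gt0 ?subr_gt0// mulr_gt0// ltr_wpDl.
have eS : e * (2 * (sqmod s + 1)) = u z0 - M.
  by rewrite /e divfK// gt_eqF// mulr_gt0// ltr_wpDl.
pose v z := u z + e * sqmod z.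
have cv z : K z -> {for z, continuous v}.
  move=> Kz; exact: contD (cu _ Kz) (contM (@cont_cst _ _ z e) (csq z)).
have [p Kp pmax] := ex_max v cv.
have vz0 : u z0 <= v p.
  by apply: le_trans (pmax _ Kz0); rewrite lerDl mulr_ge0 ?(ltW e0) ?sqmod_ge0.
have [Bp|nBp] := pselect (B p).
  have up := uB _ Kp Bp.
  have : e * sqmod p <= e * sqmod s by rewrite ler_pM2l//; exact: smax.
  move: vz0; rewrite /v; nra.
have [d [d0 Kd um]] := uI _ Kp nBp.
have cud : continuous (fun t => u (p + d * cis t)).
  by apply: continuous_circle1 => t; exact: cu.
have csd : continuous (fun t => sqmod (p + d * cis t)).
  by apply: (@continuous_circle1 (@sqmod R : C -> R)) => t; exact: csq.
have ces : continuous (fun t => e * sqmod (p + d * cis t)).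
  by move=> t; exact: contM (@cont_cst _ _ t e) (csd t).
have : mean (fun t => v (p + d * cis t)) <= v p.
  apply: mean_le_cst => [t|t]; last exact: pmax.
  exact: contD (cud t) (ces t).
rewrite (meanD cud ces) meanZ// mean_sqmod {1}/v.
have sd : 0 < sqmod d by rewrite lt_neqAle eq_sym sqmod_eq0 d0 sqmod_ge0.
have : 0 < e * sqmod d by rewrite mulr_gt0.
nra.
Qed.

(** Liouville's theorem for subharmonic functions: comparison with the harmonic
    barrier [- e ln |z|^2] outside the unit disc bounds [u] by its maximum over
    that disc, so that [u] attains its supremum. *)
Lemma liouville (u : C -> R) (A : R) : continuous u -> (forall z, u z <= A) ->
  (forall z d : C, u z <= mean (fun t => u (z + d * cis t))) ->
  forall z w, u z = u w.
Proof.
move=> cu uA sub.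
have csq (z : C) : {for z, continuous (@sqmod R : C -> R)} by exact: continuous_sqmod.
pose D : set C := [set z | sqmod z <= 1]%classic.
have D0 : (D !=set0)%classic.
  by exists 0; rewrite /D/= /sqmod/= expr0n addr0.
have [q /set_mem Dq qmax0] := compact_EVT_max D0 (@compact_sqmod R 1)
  (continuous_subspaceT cu).
have qmax z : D z -> u z <= u q by move=> Dz; apply: qmax0; exact: mem_set.
have umax z : u z <= u q.
  have [z1|z1] := leP (sqmod z) 1; first exact: qmax.
  have z0 : 0 < sqmod z by exact: lt_trans z1.
  have step e : 0 < e -> u z <= u q + e * ln (sqmod z).
    move=> e0.
    (* On the circle [|w|^2 = S] the barrier brings the bound [A] below [u q]. *)
    pose S := Num.max (sqmod z) (expR ((A - u q) / e)).
    have S0 : 0 < S by rewrite lt_max z0.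
    have Se : A - e * ln S <= u q.
      have : (A - u q) / e <= ln S.
        by rewrite -[leLHS]expRK ler_ln ?posrE ?expR_gt0// le_max lexx orbT.
      by rewrite ler_pdivrMr//; lra.
    pose K : set C := [set z | 1 <= sqmod z <= S]%classic.
    have KS : K `<=` [set z | sqmod z <= S]%classic by move=> w /= /andP[].
    have cK : compact K.
      apply: (subclosed_compact _ (@compact_sqmod R S) KS).
      rewrite (_ : K = (@sqmod R : C -> R) @^-1` `[1, S]%classic); last first.
        by apply/seteqP; split => w /=; rewrite in_itv.
      by apply: (@preimage_closed C); [move=> w _; exact: csq|exact: interval_closed].
    pose v z := u z - e * ln (sqmod z).
    have K0 w : K w -> 0 < sqmod w by move=> /andP[w1 _]; exact: lt_le_trans w1.
    have cv w : K w -> {for w, continuous v}.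
      move=> Kw; have cl := cont_ln (K0 _ Kw) (csq w).
      exact: contB (cu w) (contM (@cont_cst _ _ w e) cl).
    have vz : v z <= u q.
      apply: (@maximum_principle K (fun w => sqmod w <= 1 \/ S <= sqmod w) v) => //.
      - move=> w Kw [w1|wS].
          have -> : v w = u w.
            have w11 : sqmod w = 1 by apply: le_anti; rewrite w1; case/andP: Kw.
            by rewrite /v w11 ln1 mulr0 subr0.
          exact: qmax.
        have wSS : sqmod w = S by apply: le_anti; rewrite wS andbT; case/andP: Kw.
        by rewrite /v wSS; apply: le_trans Se; rewrite lerD2r.
      - move=> w Kw /not_orP[/negP w1 /negP wS].
        rewrite -ltNge in w1; rewrite -ltNge in wS.
        have nw : \forall y \near (w : C), 1 < sqmod y < S.
          have op : open [set y : C | 1 < sqmod y < S]%classic.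
            rewrite (_ : mkset _ = (@sqmod R : C -> R) @^-1` `]1, S[%classic); last first.
              by apply/seteqP; split => y /=; rewrite in_itv.
            by apply: (@open_comp C); [move=> y _; exact: csq|exact: interval_open].
          by apply: open_nbhs_nbhs; split; [exact: op|rewrite /= w1].
        have [r [r0 rP]] := (near_sqmod w _).1 nw.
        pose d : C := (r / 2)%:C.
        have dr : sqmod d < r ^+ 2 by rewrite sqmod_real; nra.
        have Kd t : K (w + d * cis t).
          have : sqmod (w + d * cis t - w) < r ^+ 2.
            by rewrite addrAC subrr add0r sqmodM sqmod_cis mulr1.
          by move=> /rP /andP[h1 h2]; rewrite /K/= (ltW h1) (ltW h2).
        have dw : sqmod d < sqmod w.
          apply: lt_le_trans dr _; rewrite leNgt; apply/negP => rw.
          have := rP 0; rewrite sub0r sqmodN => /(_ rw).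
          by rewrite /sqmod/= expr0n addr0 ltNge ler01.
        exists d; split => //.
          by rewrite -sqmod_eq0 sqmod_real expf_eq0/= gt_eqF ?divr_gt0.
        have cud : continuous (fun t => u (w + d * cis t)).
          exact: (@continuous_circle1 u w d (fun t => cu _)).
        have cld : continuous (fun t => - e * ln (sqmod (w + d * cis t))).
          apply: (@continuous_circle1 (fun z => - e * ln (sqmod z))) => t.
          exact: contM (@cont_cst _ _ _ (- e)) (cont_ln (K0 _ (Kd t)) (csq _)).
        rewrite (@eq_mean _ _ (fun t => u (w + d * cis t) +
           - e * ln (sqmod (w + d * cis t)))); last by move=> t; rewrite /v mulNr.
        rewrite (meanD cud cld).
        have cl : continuous (fun t => ln (sqmod (w + d * cis t))).
          apply: (@continuous_circle1 (fun z => ln (sqmod z))) => t.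
          exact: cont_ln (K0 _ (Kd t)) (csq _).
        by rewrite meanZ// mean_ln_sqmod// mulNr /v lerD2r; exact: sub.
      - by rewrite /K/= (ltW z1) le_max lexx.
    by move: vz; rewrite /v; lra.
  rewrite leNgt; apply/negP => qz.
  have lz : 0 < ln (sqmod z) by exact: ln_gt0.
  have := step ((u z - u q) / (2 * ln (sqmod z))).
  rewrite divr_gt0 ?subr_gt0 ?mulr_gt0// => /(_ isT).
  rewrite (_ : _ / _ * _ = (u z - u q) / 2); first by lra.
  by field; exact: lt0r_neq0.
suff uq z : u z = u q by move=> z w; rewrite !uq.
have cuz : continuous (fun t => u (q + (q - z) * cis t)).
  exact: (@continuous_circle1 u q (q - z) (fun t => cu _)).
have := mean_ge_max_eq cuz (fun t => umax _) (sub q (q - z)).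
by rewrite cis_pi mulrN1 opprB addrC subrK.
Qed.

End MaximumPrinciple.

Section MaximumPrincipleCC.
Variables (R : realType) (n : nat).
Local Notation CC := 'CC[R]_n.

Lemma sub_mean_line (U : set CC) f (x d : CC) (z e : R[i]) :
  sub_mean U f -> disc_in U (x + z *: d) (e *: d) ->
  f (x + z *: d) <= mean (fun t => f (x + (z + e * cis t) *: d)).
Proof.
move=> sub /sub; congr (_ <= _); apply: eq_mean => t.
by rewrite scalerDl addrA scalerA [cis t * _]mulrC.
Qed.

(** The circle through [x - d] with centre [x] meets it at the angle [pi]. *)
Lemma strong_maximum_disc (U : set CC) f (x d : CC) (M : R) :
  (forall y, U y -> {for y, continuous f}) -> sub_mean U f ->
  disc_in U x d -> (forall t, f (x + cis t *: d) <= M) -> M <= f x ->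
  f (x - d) = M.
Proof.
move=> cf sub xd fM Mx.
have cc : continuous (fun t : R => f (x + cis t *: d)).
  by apply: continuous_circle => t; apply: cf; exact: disc_circle.
have := mean_ge_max_eq cc fM (le_trans Mx (sub x d xd)).
by rewrite cis_pi scaleN1r.
Qed.

Lemma liouville_line (U : set CC) f (x d : CC) (A : R) :
  (forall y, U y -> {for y, continuous f}) -> sub_mean U f ->
  (forall y, U y -> f y <= A) -> (forall z, U (x + z *: d)) ->
  forall z, f (x + z *: d) = f x.
Proof.
move=> cf sub fA Uxd z.
pose u (z : R[i]^o) := f (x + z *: d).
have cu : continuous u.
  move=> w; have c := @continuous_affine R n _ (fun z : R[i]^o => z) w x d (@cvg_id _ _).
  exact: (continuous_comp c (cf _ (Uxd w))).
have -> : f x = u 0 by rewrite /u scale0r addr0.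
apply: (@liouville _ u A cu) => [w|w e]; first exact: fA.
apply: sub_mean_line (sub) _ => v _.
by rewrite -addrA scalerA -scalerDl.
Qed.

End MaximumPrincipleCC.

(** * The weights with dense poles *)

Section Weight.
Variable R : realType.
Implicit Types (z d : R[i]) (t e : R) (j k : nat).

(** Enumerating the rational angles by their codes makes the poles dense in the
    unit circle; the numbers that code no rational give the angle [0]. *)
Definition pole j : R[i] := cis (ratr (odflt 0 (unpickle j : option rat))).

Lemma sqmod_pole j : sqmod (pole j) = 1.
Proof. exact: sqmod_cis. Qed.

Lemma pole_dense (q : rat) : exists j, pole j = cis (ratr q).
Proof. by exists (pickle q); rewrite /pole pickleK. Qed.

(** The total mass [1/100] is small enough for the sum of the terms
    [- 2 coef |z|^2] to leave half of the leading [2 |z|^2] of the weight, and for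
    the weight to vary slowly near [0]. *)
Definition coef j : R := 100^-1 * 2^-1 ^+ j.+1.
Definition eps k : R := k.+1%:R^-1.

Lemma coef_gt0 j : 0 < coef j.
Proof. by rewrite mulr_gt0 ?invr_gt0// exprn_gt0// invr_gt0. Qed.

Lemma eps_gt0 k : 0 < eps k. Proof. by rewrite invr_gt0. Qed.
Lemma eps_le1 k : eps k <= 1. Proof. by rewrite invf_le1// ler1n. Qed.

Lemma eps_decr k : eps k.+1 <= eps k.
Proof. by rewrite lef_pV2 ?posrE// ler_nat. Qed.

Lemma sum_coef k : \sum_(j < k) coef j = 100^-1 * (1 - 2^-1 ^+ k).
Proof.
elim: k => [|k IH]; first by rewrite big_ord0 expr0 subrr mulr0.
by rewrite big_ord_recr/= IH /coef -mulrDr exprS; congr (_ * _); lra.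
Qed.

Lemma sum_coef_le k : \sum_(j < k) coef j <= 100^-1.
Proof.
rewrite sum_coef ler_piMr ?invr_ge0// gerBl exprn_ge0// invr_ge0//.
Qed.

Definition logterm e j z : R := ln (sqmod (z - pole j) + e).
Definition wterm k j z : R := coef j * (logterm (eps k) j z - 2 * sqmod z - 2).

(** The functions [weight k] decrease to a subharmonic function with
    logarithmic poles at all [pole j], which is locally bounded off the unit
    circle. Subtracting [2 |z|^2 + 2] makes every summand nonpositive, whence
    the monotonicity, and the leading [2 |z|^2] restores subharmonicity. *)
Definition weight k z : R := 2 * sqmod z + \sum_(j < k) wterm k j z.

Lemma logterm_arg_gt0 e j z : 0 < e -> 0 < sqmod (z - pole j) + e.
Proof. by move=> e0; rewrite ltr_wpDl// sqmod_ge0. Qed.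

Lemma wterm_le0 k j z : wterm k j z <= 0.
Proof.
rewrite /wterm pmulr_rle0 ?coef_gt0// /logterm.
have := logterm_arg_gt0 j z (eps_gt0 k).
have := sqmodD_le z (- pole j); rewrite sqmodN sqmod_pole => h.
set y := sqmod _ + _ => y0.
have : ln y <= y - 1 by rewrite -{1}(subrKC 1 y) le_ln1Dx//; lra.
by have := eps_le1 k; rewrite /y; lra.
Qed.

Lemma wterm_decr k j z : wterm k.+1 j z <= wterm k j z.
Proof.
rewrite /wterm ler_pM2l ?coef_gt0// !lerD2r /logterm.
by rewrite ler_ln ?posrE ?logterm_arg_gt0 ?eps_gt0// lerD2l eps_decr.
Qed.

Lemma weight_decr k z : weight k.+1 z <= weight k z.
Proof.
rewrite /weight lerD2l big_ord_recr/= -[leRHS]addr0 lerD ?wterm_le0//.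
by apply: ler_sum => j _; exact: wterm_decr.
Qed.

Lemma weight_le k z : weight k z <= 2 * sqmod z.
Proof. by rewrite gerDl sumr_le0// => j _; exact: wterm_le0. Qed.

(** At its own pole the [j]-th logarithm is [ln (eps k)], which tends to [-oo],
    while the other terms stay nonpositive. *)
Lemma weight_pole j (M : R) : exists k, weight k (pole j) <= M.
Proof.
pose B := (2 - M) / coef j.
pose m := Num.bound (expR B).
exists (m + j.+1)%N.
have jk : (j < m + j.+1)%N by rewrite addnS ltnS leq_addl.
rewrite /weight (bigD1 (Ordinal jk))//= sqmod_pole.
have : wterm (m + j.+1) j (pole j) <= coef j * (- B).
  rewrite /wterm ler_pM2l ?coef_gt0// /logterm subrr sqmod_pole.
  rewrite (_ : sqmod 0 = 0) ?add0r; last by rewrite /sqmod/= expr0n addr0.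
  rewrite /eps lnV ?posrE//.
  have : B <= ln ((m + j.+1).+1%:R : R).
    rewrite -[leLHS]expRK ler_ln ?posrE ?expR_gt0//.
    apply: le_trans (ltW (archi_boundP (expR_ge0 B))) _.
    by rewrite ler_nat -/m -addnS leq_addr.
  lra.
rewrite mulrN /B mulrCA divff ?gt_eqF ?coef_gt0// mulr1 => h.
have : \sum_(i < m + j.+1 | i != Ordinal jk) wterm (m + j.+1) i (pole j) <= 0.
  by rewrite sumr_le0// => i _; exact: wterm_le0.
lra.
Qed.

Lemma sqmod_pole_ge j z : sqmod z <= 4^-1 -> 4^-1 <= sqmod (z - pole j).
Proof.
move=> z4; have := sqmod_pole j; have := sqmod_cross z (pole j).
move: z4; rewrite /sqmod !complex_ReD !complex_ImD !complex_ReN !complex_ImN.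
set a := Re z; set b := Im z; set p := Re _; set q := Im _.
move=> z4 cr pq; have := sqr_ge0 (a * q - b * p) => h.
have ap2 : (a * p + b * q) ^+ 2 <= a ^+ 2 + b ^+ 2 by rewrite pq in cr; lra.
set c := a * p + b * q in ap2.
have -> : (a - p) ^+ 2 + (b - q) ^+ 2 = (a ^+ 2 + b ^+ 2) + 1 - 2 * c.
  transitivity (a ^+ 2 + b ^+ 2 + (p ^+ 2 + q ^+ 2) - 2 * c); last by rewrite pq.
  by rewrite /c; ring.
have c2 : c <= 2^-1 by rewrite leNgt; apply/negP => h'; nra.
by apply: (@le_trans _ _ ((1 - c) ^+ 2)); nra.
Qed.

Lemma ln4_le3 : ln (4 : R) <= 3.
Proof. by rewrite (_ : 4 = 1 + 3) ?le_ln1Dx//; lra. Qed.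

(** The poles are at distance at least [1/2] from the disc of radius [1/2], so
    each logarithm is at least [- ln 4] there. *)
Lemma weight_ge k z : sqmod z <= 4^-1 -> -1 <= weight k z.
Proof.
move=> z4.
have : - (6 * 100^-1) <= \sum_(j < k) wterm k j z.
  apply: (@le_trans _ _ (\sum_(j < k) - 6 * coef j)).
    rewrite -mulr_sumr mulNr lerN2 ler_pM2l//; exact: sum_coef_le.
  apply: ler_sum => j _; rewrite /wterm mulrC ler_pM2l ?coef_gt0//.
  have : ln 4^-1 <= logterm (eps k) j z.
    rewrite ler_ln ?posrE ?logterm_arg_gt0 ?eps_gt0//.
    by have := sqmod_pole_ge j z4; have := eps_gt0 k; lra.
  by rewrite lnV ?posrE//; have := ln4_le3; lra.
by rewrite /weight; have := sqmod_ge0 z; lra.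
Qed.

Lemma sqmod_diff z w (B : R) : 0 <= B -> sqmod (z + w) <= B ^+ 2 ->
  `|sqmod z - sqmod w| <= B * Num.sqrt (sqmod (z - w)).
Proof.
move=> B0 zwB; set s := Num.sqrt _.
have s0 : 0 <= s by exact: sqrtr_ge0.
have s2 : s ^+ 2 = sqmod (z - w) by rewrite sqr_sqrtr// sqmod_ge0.
rewrite -(@ler_sqr _ `|_|) ?nnegrE ?mulr_ge0// real_normK ?num_real//.
rewrite exprMn s2.
apply: le_trans (ler_wpM2r (sqmod_ge0 _) zwB).
rewrite /sqmod !complex_ReD !complex_ImD !complex_ReN !complex_ImN.
have := sqr_ge0 (Re w * Im z - Re z * Im w); nra.
Qed.

Lemma ln_diff (a b : R) : 4^-1 <= a -> 4^-1 <= b -> `|ln a - ln b| <= 4 * `|a - b|.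
Proof.
have half (x y : R) : 4^-1 <= x -> 4^-1 <= y -> ln x - ln y <= 4 * `|x - y|.
  move=> x4 y4; have x0 : 0 < x by lra.
  have y0 : 0 < y by lra.
  rewrite -ln_div ?posrE//.
  have -> : x / y = 1 + (x - y) / y by field; exact: lt0r_neq0.
  apply: le_trans (_ : (x - y) / y <= _).
    by apply: le_ln1Dx; rewrite ltr_pdivlMr//; lra.
  rewrite ler_pdivrMr//; have := ler_norm (x - y); have := normr_ge0 (x - y).
  nra.
move=> a4 b4; rewrite ler_norml lerNl opprB half// distrC half//.
Qed.

(** Away from the poles each logarithm is Lipschitz, uniformly in [k] and [j];
    the constant [1/2] is what [mean_sqmod_expR_gain] tolerates. *)
Lemma weight_lipschitz k z w : sqmod z <= 256^-1 -> sqmod w <= 256^-1 ->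
  `|weight k z - weight k w| <= 2^-1 * Num.sqrt (sqmod (z - w)).
Proof.
move=> z1 w1; set s := Num.sqrt _.
have s0 : 0 <= s by exact: sqrtr_ge0.
have zw := sqmodD_le z w.
have d8 : `|sqmod z - sqmod w| <= 8^-1 * s by apply: sqmod_diff; lra.
have term j : `|wterm k j z - wterm k j w| <= coef j * (13 * s).
  rewrite /wterm -mulrBr normrM gtr0_norm ?coef_gt0// ler_pM2l ?coef_gt0//.
  rewrite (_ : _ - _ = (logterm (eps k) j z - logterm (eps k) j w) -
    2 * (sqmod z - sqmod w)); last by ring.
  apply: le_trans (ler_normB _ _) _; rewrite normrM ger0_norm//.
  have : `|logterm (eps k) j z - logterm (eps k) j w| <= 4 * (3 * s).
    have e0 := eps_gt0 k.
    have hz : 4^-1 <= sqmod (z - pole j) by apply: sqmod_pole_ge; lra.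
    have hw : 4^-1 <= sqmod (w - pole j) by apply: sqmod_pole_ge; lra.
    apply: le_trans (ln_diff _ _) _; [lra|lra|].
    rewrite ler_pM2l// opprD addrACA subrr addr0.
    rewrite (_ : s = Num.sqrt (sqmod ((z - pole j) - (w - pole j)))); last first.
      by congr (Num.sqrt (sqmod _)); rewrite opprB addrA subrK.
    apply: sqmod_diff => //.
    have := sqmodD_le (z + w) (- pole j - pole j).
    have := sqmodD_le (- pole j) (- pole j).
    by rewrite !sqmodN sqmod_pole addrACA; lra.
  lra.
rewrite /weight opprD addrACA -mulrBr -sumrB.
apply: le_trans (ler_normD _ _) _; rewrite normrM ger0_norm//.
have : `|\sum_(i < k) (wterm k i z - wterm k i w)| <= 100^-1 * (13 * s).
  apply: le_trans (ler_norm_sum _ _ _) _.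
  apply: (@le_trans _ _ (\sum_(i < k) coef i * (13 * s))).
    by apply: ler_sum => i _; exact: term.
  by rewrite -mulr_suml ler_wpM2r ?sum_coef_le// mulr_ge0.
lra.
Qed.

End Weight.

(** * Circle means of the weights *)

Section WeightMean.
Variable R : realType.
Local Notation C := (R[i]^o).

Lemma continuous_logterm (e : R) j : 0 < e ->
  continuous (fun z : C => logterm e j z).
Proof.
move=> e0 z; apply: (@cont_ln _ _ (fun z : C => sqmod (z - pole R j) + e)).
  exact: logterm_arg_gt0.
have c : {for z, continuous (fun z : C => z - pole R j)}.
  exact: cvgD (@cvg_id _ _) (cvg_cst _).
have cs : {for z, continuous (fun z : C => sqmod (z - pole R j))}.
  exact: (continuous_comp c (@continuous_sqmod R _)).
exact: contD cs (@cont_cst _ _ z e).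
Qed.

Lemma continuous_wterm k j : continuous (fun z : C => @wterm R k j z).
Proof.
move=> z; have cl := @continuous_logterm _ j (@eps_gt0 R k) z.
have cs := contM (@cont_cst R C z 2) (@continuous_sqmod R z).
exact: contM (@cont_cst _ _ z (coef R j)) (contB (contB cl cs) (@cont_cst _ _ z 2)).
Qed.

Lemma continuous_weight k : continuous (fun z : C => @weight R k z).
Proof.
move=> z; have cs := contM (@cont_cst R C z 2) (@continuous_sqmod R z).
apply: (contD cs); apply: cont_sum => j; exact: continuous_wterm.
Qed.

(** The logarithm loses nothing on circle means, and [- 2 coef |z|^2] loses
    exactly [2 coef |d|^2]. *)
Lemma mean_wterm k j (z d : R[i]) :
  wterm k j z - 2 * coef R j * sqmod d <= mean (fun t => wterm k j (z + d * cis t)).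
Proof.
have e0 := @eps_gt0 R k.
have c1 : continuous (fun t : R => logterm (eps R k) j (z + d * cis t)).
  by apply: (@continuous_circle1 _ (fun z : C => logterm _ _ z)) => t; exact: continuous_logterm.
have c2 : continuous (fun t : R => sqmod (z + d * cis t)).
  by apply: (@continuous_circle1 _ (fun z : C => sqmod z)) => t; exact: continuous_sqmod.
have c1' : continuous (fun t : R => coef R j * logterm (eps R k) j (z + d * cis t)).
  by move=> t; exact: contM (@cont_cst _ _ t _) (c1 t).
have c2' : continuous (fun t : R => - (2 * coef R j) * sqmod (z + d * cis t)).
  by move=> t; exact: contM (@cont_cst _ _ t _) (c2 t).
have c3 : continuous (fun t : R => - (2 * coef R j) : R).
  by move=> t; exact: cvg_cst.
have c23 : continuous (fun t : R =>
    - (2 * coef R j) * sqmod (z + d * cis t) + - (2 * coef R j)).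
  by move=> t; exact: contD (c2' t) (c3 t).
rewrite (@eq_mean _ _ (fun t => coef R j * logterm (eps R k) j (z + d * cis t) +
   (- (2 * coef R j) * sqmod (z + d * cis t) + - (2 * coef R j)))); last first.
  by move=> t; rewrite /wterm; ring.
rewrite (meanD c1' c23) (meanD c2' c3) !meanZ// mean_cst mean_sqmod.
have : logterm (eps R k) j z <= mean (fun t => logterm (eps R k) j (z + d * cis t)).
  apply: le_trans (mean_ln_sqmod_ge _ d e0) _; rewrite le_eqVlt; apply/orP; left.
  by apply/eqP/eq_mean => t; rewrite /logterm (addrAC z).
by move=> /(ler_wpM2l (ltW (coef_gt0 R j))); rewrite /wterm; lra.
Qed.

Lemma continuous_weight_circle k (z d : R[i]) :
  continuous (fun t : R => weight k (z + d * cis t)).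
Proof.
by apply: (@continuous_circle1 _ (fun z : C => weight k z)) => t; exact: continuous_weight.
Qed.

Lemma mean_weight k (z d : R[i]) :
  weight k z + sqmod d <= mean (fun t => weight k (z + d * cis t)).
Proof.
have c2 : continuous (fun t : R => sqmod (z + d * cis t)).
  by apply: (@continuous_circle1 _ (fun z : C => sqmod z)) => t; exact: continuous_sqmod.
have c2' : continuous (fun t : R => 2 * sqmod (z + d * cis t)).
  by move=> t; exact: contM (@cont_cst _ _ t _) (c2 t).
have cw (j : 'I_k) : continuous (fun t : R => wterm k j (z + d * cis t)).
  by apply: (@continuous_circle1 _ (fun z : C => wterm k j z)) => t; exact: continuous_wterm.
have cs : continuous (fun t : R => \sum_(j < k) wterm k j (z + d * cis t)).
  by move=> t; apply: cont_sum => j; exact: cw.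
rewrite /weight (meanD c2' cs) meanZ// mean_sqmod mean_sum//.
have : \sum_(j < k) (wterm k j z - 2 * coef R j * sqmod d) <=
    \sum_(j < k) mean (fun t => wterm k j (z + d * cis t)).
  by apply: ler_sum => j _; exact: mean_wterm.
rewrite sumrB -mulr_suml -mulr_sumr.
have := ler_wpM2r (sqmod_ge0 d) (sum_coef_le R k).
have := sqmod_ge0 d; lra.
Qed.

Lemma continuous_mul (f g : R -> R) : continuous f -> continuous g ->
  continuous (fun t => f t * g t).
Proof. by move=> cf cg t; exact: contM (cf t) (cg t). Qed.

Lemma continuous_sqmod_circle (a b : R[i]) :
  continuous (fun t : R => sqmod (a + b * cis t)).
Proof.
by apply: (@continuous_circle1 _ (fun z : C => sqmod z)) => t; exact: continuous_sqmod.
Qed.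

Lemma continuous_expR_comp (v : R -> R) : continuous v ->
  continuous (fun t => expR (v t)).
Proof. by move=> cv t; exact: cont_expR (cv t). Qed.

(** [|a + b z|^2 e^v = e^(ln |a + b z|^2 + v)]; the zero of the linear factor is
    avoided by adding [e > 0] to its square. *)
Lemma mean_sqmod_expR (a b : R[i]) (v : R -> R) (v0 : R) :
  continuous v -> v0 <= mean v ->
  sqmod a * expR v0 <= mean (fun t => sqmod (a + b * cis t) * expR (v t)).
Proof.
move=> cv vm.
have cab := @continuous_sqmod_circle a b.
have ce := continuous_expR_comp cv.
have cm := continuous_mul cab ce.
have step e : 0 < e -> sqmod a * expR v0 <=
    mean (fun t => sqmod (a + b * cis t) * expR (v t)) + e * mean (fun t => expR (v t)).
  move=> e0.
  have pos t : 0 < sqmod (a + b * cis t) + e by rewrite ltr_wpDl// sqmod_ge0.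
  have cl : continuous (fun t => ln (sqmod (a + b * cis t) + e)).
    by move=> t; apply: (@cont_ln _ _ (fun t => sqmod (a + b * cis t) + e)) => //; exact: contD (cab t) (@cont_cst _ _ t e).
  have clv : continuous (fun t => ln (sqmod (a + b * cis t) + e) + v t).
    by move=> t; exact: contD (cl t) (cv t).
  have cee : continuous (fun t => e * expR (v t)).
    by move=> t; exact: contM (@cont_cst _ _ t e) (ce t).
  have a0 : 0 < sqmod a + e by rewrite ltr_wpDl// sqmod_ge0.
  rewrite -meanZ// -meanD//.
  apply: (@le_trans _ _ (expR (ln (sqmod a + e) + v0))).
    rewrite expRD lnK ?posrE// ler_wpM2r ?expR_ge0// lerDl; exact: ltW.
  apply: (@le_trans _ _ (expR (mean (fun t => ln (sqmod (a + b * cis t) + e) + v t)))).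
    by rewrite ler_expR meanD// lerD// mean_ln_sqmod_ge.
  apply: le_trans (jensen_exp clv) _.
  rewrite le_eqVlt; apply/orP; left; apply/eqP/eq_mean => t.
  by rewrite expRD lnK ?posrE// mulrDl.
rewrite leNgt; apply/negP => H.
set E := mean (fun t => expR (v t)) in step.
have E0 : 0 <= E by apply: mean_ge_cst => // t; exact: expR_ge0.
have := step ((sqmod a * expR v0 - mean (fun t => sqmod (a + b * cis t) * expR (v t))) / (2 * (E + 1))).
have E1 : 0 < 2 * (E + 1) by rewrite mulr_gt0// ltr_wpDl.
rewrite divr_gt0 ?subr_gt0// => /(_ isT).
set X := _ - _ in H *; set Y := mean _ in X H *.
have X0 : 0 < X by rewrite subr_gt0.
have -> : X / (2 * (E + 1)) * E = X / 2 - X / (2 * (E + 1)).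
  by field; apply: lt0r_neq0; rewrite ltr_wpDl.
have : 0 < X / (2 * (E + 1)) by rewrite divr_gt0.
by rewrite /X; lra.
Qed.

(** Since [v] varies little, the strict gain of [|a + b z|^2] in the direction
    [b] and that of [v] are not destroyed by the mixed terms. *)
Lemma mean_sqmod_expR_gain (a b : R[i]) (v : R -> R) (v0 r : R) :
  continuous v -> 0 <= r <= 8^-1 -> (forall t, `|v t - v0| <= 2^-1 * r) ->
  v0 + r ^+ 2 <= mean v ->
  expR v0 * (sqmod a + sqmod a * r ^+ 2 / 2 + sqmod b / 4) <=
    mean (fun t => sqmod (a + b * cis t) * expR (v t)).
Proof.
move=> cv /andP[r0 r8] vr vm.
set A := sqmod a; set B := sqmod b.
have A0 : 0 <= A by exact: sqmod_ge0.
have B0 : 0 <= B by exact: sqmod_ge0.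
pose p : R := Re a * Re b + Im a * Im b.
pose m : R := Re a * Im b - Im a * Re b.
(* Pointwise the integrand dominates [expR v0] times a trigonometric polynomial
   of mean [K] plus [A * (v - v0)]: use [expR D >= 1 + D] and absorb the mixed
   terms by [2 c D >= - (B / 2 + 2 A D^2)], where [c^2 <= A B]. *)
pose K : R := A + B / 4 - A * r ^+ 2 / 2.
have cT := @continuous_trig R K (2 * p) (2 * m).
have cD : continuous (fun t => A * (v t - v0)).
  by move=> t; exact: contM (@cont_cst _ _ t A) (contB (cv t) (@cont_cst _ _ t v0)).
have cS : continuous (fun t => trig K (2 * p) (2 * m) t + A * (v t - v0)).
  by move=> t; exact: contD (cT t) (cD t).
have cE : continuous (fun t => expR v0 * (trig K (2 * p) (2 * m) t + A * (v t - v0))).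
  by move=> t; exact: contM (@cont_cst _ _ t _) (cS t).
have cv0 : continuous (fun t : R => - v0 : R) by move=> t; exact: cvg_cst.
have cvv : continuous (fun t => v t - v0) by move=> t; exact: contD (cv t) (cv0 t).
apply: (@le_trans _ _ (mean (fun t => expR v0 * (trig K (2 * p) (2 * m) t + A * (v t - v0))))).
  rewrite meanZ// ler_pM2l ?expR_gt0// (meanD cT cD) mean_trig meanZ//.
  rewrite (meanD cv cv0) mean_cst.
  have := ler_wpM2l A0 vm; rewrite /K; lra.
apply: mean_le => //.
  exact: continuous_mul (@continuous_sqmod_circle a b) (continuous_expR_comp cv).
move=> t; rewrite [leRHS]mulrC.
have -> : expR (v t) = expR v0 * expR (v t - v0) by rewrite -expRD addrC subrK.
rewrite -mulrA ler_pM2l ?expR_gt0//.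
set D := v t - v0.
have D2 : D ^+ 2 <= r ^+ 2 / 4.
  have := vr t; rewrite -/D -ler_sqr ?nnegrE ?mulr_ge0 ?normr_ge0//.
  by rewrite real_normK ?num_real//; lra.
have D4 : - 4^-1 <= D.
  by have := vr t; rewrite -/D ler_norml => /andP[h _]; lra.
apply: (@le_trans _ _ ((1 + D) * sqmod (a + b * cis t))); last first.
  by rewrite ler_wpM2r ?sqmod_ge0// expR_ge1Dx.
rewrite sqmod_circle /trig -/p -/m -/A -/B.
have := trig_sqr_le p m t; rewrite sqmod_cross -/A -/B.
set c := p * cos t - m * sin t => cAB.
have -> : 2 * p * cos t - 2 * m * sin t = 2 * c by rewrite /c; ring.
have cD2 : - (B / 2 + 2 * A * D ^+ 2) <= 2 * c * D.
  have y0 : 0 <= B / 2 + 2 * A * D ^+ 2.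
    by rewrite addr_ge0 ?divr_ge0// mulr_ge0 ?sqr_ge0// mulr_ge0.
  have : (2 * c * D) ^+ 2 <= (B / 2 + 2 * A * D ^+ 2) ^+ 2.
    apply: (@le_trans _ _ (4 * (A * B) * D ^+ 2)).
      rewrite !exprMn ler_wpM2r ?sqr_ge0//; lra.
    have := sqr_ge0 (B / 2 - 2 * A * D ^+ 2); lra.
  rewrite -[X in X <= _]real_normK ?num_real// ler_sqr ?nnegrE//.
  by rewrite ler_norml => /andP[].
have BD : - (B / 4) <= B * D by nra.
have AD : A * D ^+ 2 <= A * (r ^+ 2 / 4) by rewrite ler_wpM2l.
rewrite /K; lra.
Qed.

End WeightMean.

(** * The Hartogs domain *)

Section Domain.
Variables (R : realType) (n : nat) (i0 : 'I_n).
Local Notation CC := 'CC[R]_n.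
Implicit Types (x y d : CC) (k : nat).

(** Writing a point as [(z, w)] with [z] its coordinate of index [i0], this is
    [|w|^2]. *)
Definition transv x : R := \sum_(i | i != i0) sqmod (x 0 i).

Definition dfun k x : R := transv x * expR (weight k (x 0 i0)).

Definition dfun_lim x : R := inf (range (fun k => dfun k x)).

(** The Hartogs domain [|w|^2 e^(V(z)) < 1], with [V] the limit of the
    decreasing sequence of the weights, as an increasing union; with a strict
    inequality the union agrees with the sublevel set of the infimum
    ([OmegaP]). *)
Definition Omega : set CC := [set x | exists k, dfun k x < 1]%classic.

Lemma transv_ge0 x : 0 <= transv x.
Proof. by apply: sumr_ge0 => i _; exact: sqmod_ge0. Qed.

Lemma sqnorm_transv x : sqnorm x = sqmod (x 0 i0) + transv x.
Proof. by rewrite /sqnorm (bigD1 i0). Qed.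

Lemma transvZ (z : R[i]) x : transv (z *: x) = sqmod z * transv x.
Proof.
by rewrite /transv mulr_sumr; apply: eq_bigr => i _; rewrite mxE sqmodM.
Qed.

Lemma dfun_ge0 k x : 0 <= dfun k x.
Proof. by rewrite mulr_ge0 ?transv_ge0// expR_ge0. Qed.

Lemma dfun_decrS k x : dfun k.+1 x <= dfun k x.
Proof. by rewrite ler_wpM2l ?transv_ge0// ler_expR weight_decr. Qed.

Lemma dfun_decr k m x : (k <= m)%N -> dfun m x <= dfun k x.
Proof.
elim: m => [|m IH]; first by rewrite leqn0 => /eqP ->.
by rewrite leq_eqVlt ltnS => /orP[/eqP -> //|/IH]; exact: le_trans (dfun_decrS _ _).
Qed.

Lemma continuous_transv x : {for x, continuous transv}.
Proof.
apply: cont_sum => i; have := @continuous_coord_sqmod R n i x 0.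
rewrite (_ : (fun y => _) = (fun y : CC => sqmod (y 0 i)))//.
by apply/funext => y; rewrite mxE subr0.
Qed.

Lemma continuous_dfun k x : {for x, continuous (dfun k)}.
Proof.
have cw : {for x, continuous (fun y : CC => weight k (y 0 i0))}.
  exact: continuous_comp (@coord_continuous _ _ _ 0 i0 x) (@continuous_weight R k _).
exact: contM (@continuous_transv x) (cont_expR cw).
Qed.

Lemma coord_circle x d i t : (x + cis t *: d) 0 i = x 0 i + d 0 i * cis t.
Proof. by rewrite !mxE mulrC. Qed.

Lemma mean_dfun k x d : mean (fun t => dfun k (x + cis t *: d)) =
  \sum_(i | i != i0) mean (fun t => sqmod (x 0 i + d 0 i * cis t) *
    expR (weight k (x 0 i0 + d 0 i0 * cis t))).
Proof.
rewrite -mean_sum.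
  apply: eq_mean => t; rewrite /dfun /transv mulr_suml coord_circle.
  by apply: eq_bigr => i _; rewrite coord_circle.
move=> i; apply: continuous_mul; first exact: continuous_sqmod_circle.
by apply: continuous_expR_comp; exact: continuous_weight_circle.
Qed.

Lemma dfun_sub_mean k x d : dfun k x <= mean (fun t => dfun k (x + cis t *: d)).
Proof.
rewrite mean_dfun /dfun /transv mulr_suml; apply: ler_sum => i _.
apply: mean_sqmod_expR; first exact: continuous_weight_circle.
by apply: le_trans (mean_weight _ _ _); rewrite lerDl sqmod_ge0.
Qed.

(** The component of [d] in the direction of [z] gains through the weight, by a
    factor [|w|^2] that [x 0 i1] keeps away from [0]; the other components gain
    through [|w|^2] itself, by the factor [e^V >= e^(-1)]. The constant does not
    depend on [k], so the gain survives in the limit. *)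
Lemma dfun_gain k i1 x d : i1 != i0 ->
  (forall w : R[i], sqmod w <= 1 -> sqmod ((x + w *: d) 0 i0) <= 256^-1) ->
  256^-1 <= sqmod (x 0 i1) ->
  dfun k x + expR (-1) / 512 * sqnorm d <=
    mean (fun t => dfun k (x + cis t *: d)).
Proof.
move=> i10 zd x1.
have zt t : sqmod (x 0 i0 + d 0 i0 * cis t) <= 256^-1.
  by rewrite -coord_circle; apply: zd; rewrite sqmod_cis.
have z0 : sqmod (x 0 i0) <= 256^-1.
  by have := zd 0; rewrite scale0r addr0; apply; rewrite /sqmod/= expr0n addr0.
pose r := Num.sqrt (sqmod (d 0 i0)).
have r2 : r ^+ 2 = sqmod (d 0 i0) by rewrite sqr_sqrtr ?sqmod_ge0.
have r0 : 0 <= r by exact: sqrtr_ge0.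
have r8 : r <= 8^-1.
  have := zd 1; rewrite scale1r mxE /sqmod/= expr1n expr0n addr0 lexx => /(_ isT).
  rewrite -/(sqmod _) => h; have := sqmodD_le (x 0 i0 + d 0 i0) (- x 0 i0).
  rewrite addrAC subrr add0r sqmodN -r2 => h2.
  rewrite -ler_sqr ?nnegrE//; lra.
set v0 := weight k (x 0 i0).
have v1 : -1 <= v0 by apply: weight_ge; lra.
have term i : i != i0 -> sqmod (x 0 i) * expR v0 + expR v0 *
    (sqmod (x 0 i) * r ^+ 2 / 2 + sqmod (d 0 i) / 4) <=
    mean (fun t => sqmod (x 0 i + d 0 i * cis t) *
      expR (weight k (x 0 i0 + d 0 i0 * cis t))).
  move=> _.
  have cw := @continuous_weight_circle R k (x 0 i0) (d 0 i0).
  have h := @mean_sqmod_expR_gain R (x 0 i) (d 0 i) _ v0 r cw.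
  apply: le_trans (h _ _ _).
  - by rewrite le_eqVlt; apply/orP; left; apply/eqP; ring.
  - by rewrite r0.
  - move=> t; apply: le_trans (weight_lipschitz _ (zt t) z0) _.
    by rewrite addrAC subrr add0r sqmodM sqmod_cis mulr1.
  - by rewrite r2 mean_weight.
rewrite mean_dfun /dfun -/v0.
apply: le_trans (ler_sum _ term); rewrite big_split/= -mulr_suml -/(transv x) lerD2l.
rewrite -mulr_sumr big_split/= -!mulr_suml -/(transv d) -/(transv x) r2.
have tx : 256^-1 <= transv x.
  apply: le_trans x1 _; rewrite /transv (bigD1 i1)//= lerDl.
  by apply: sumr_ge0 => i _; exact: sqmod_ge0.
rewrite sqnorm_transv -mulrA.
have d0 := sqmod_ge0 (d 0 i0); have dw := transv_ge0 d.
apply: (@le_trans _ _ (expR (-1) * (transv x * sqmod (d 0 i0) / 2 + transv d / 4))).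
  rewrite ler_wpM2l ?expR_ge0//.
  have := ler_wpM2r d0 tx; lra.
apply: ler_wpM2r; last by rewrite ler_expR.
by rewrite addr_ge0 ?divr_ge0// mulr_ge0// transv_ge0.
Qed.

Lemma has_lbound_dfun x : has_lbound (range (fun k => dfun k x)).
Proof. by exists 0 => _ [k _ <-]; exact: dfun_ge0. Qed.

Lemma range_dfun_nonempty x : (range (fun k => dfun k x) !=set0)%classic.
Proof. by exists (dfun 0 x), 0%N. Qed.

Lemma dfun_lim_le k x : dfun_lim x <= dfun k x.
Proof. by apply: ge_inf; [exact: has_lbound_dfun|exists k]. Qed.

Lemma dfun_lim_ge0 x : 0 <= dfun_lim x.
Proof.
apply: lb_le_inf; first exact: range_dfun_nonempty.
by move=> _ [k _ <-]; exact: dfun_ge0.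
Qed.

Lemma cvg_dfun x : dfun k x @[k --> \oo] --> dfun_lim x.
Proof.
apply: nonincreasing_cvgn; last exact: has_lbound_dfun.
by move=> k m km; exact: dfun_decr.
Qed.

Lemma dfun_lim_lt x (a : R) : dfun_lim x < a -> exists k, dfun k x < a.
Proof.
by move=> /(inf_lt (range_dfun_nonempty x))[_ [k _ <-]]; exists k.
Qed.

Lemma OmegaP x : Omega x <-> dfun_lim x < 1.
Proof.
split; last exact: dfun_lim_lt.
by move=> [k]; apply: le_lt_trans; exact: dfun_lim_le.
Qed.

Lemma dfun_near k x (a : R) : dfun k x < a -> \forall y \near x, dfun k y < a.
Proof.
move=> ka; have := @continuous_dfun k x.
move/(@cvgrPdist_lt R R _ (nbhs x) _ (dfun k) (dfun k x))/(_ (a - dfun k x)).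
by rewrite subr_gt0 => /(_ ka); apply: filterS => w /ltr_normlP[h1 h2]; lra.
Qed.

Lemma open_Omega : open Omega.
Proof.
rewrite openE => x [k kx]; have := dfun_near kx.
by apply: filterS => y ky; exists k.
Qed.

Lemma Omega_axis x : transv x = 0 -> Omega x.
Proof. by move=> x0; exists 0%N; rewrite /dfun x0 mul0r. Qed.

Lemma Omega_pole x j : x 0 i0 = pole R j -> Omega x.
Proof.
move=> xj; have [k kM] := weight_pole j (- transv x).
exists k; rewrite /dfun xj.
apply: (@le_lt_trans _ _ (transv x * expR (- transv x))).
  by rewrite ler_wpM2l ?transv_ge0// ler_expR.
rewrite expRN ltr_pdivrMr ?expR_gt0// mul1r.
by apply: lt_le_trans (expR_ge1Dx _); lra.
Qed.

Lemma Omega_cylinder x : sqmod (x 0 i0) <= 1 -> transv x < 16^-1 -> Omega x.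
Proof.
move=> z1 w1; exists 0%N; rewrite /dfun.
have e2 : expR (2^-1) <= 2 :> R.
  have : 1 + - 2^-1 <= expR (- 2^-1) :> R by exact: expR_ge1Dx.
  rewrite expRN => /(ler_wpM2l (expR_ge0 (2^-1))).
  by rewrite divff ?gt_eqF ?expR_gt0//; lra.
have e16 : expR (weight 0 (x 0 i0)) <= 16.
  apply: (@le_trans _ _ (expR 2)).
    by rewrite ler_expR; apply: le_trans (weight_le _ _) _; lra.
  have -> : (2 : R) = 4%:R * 2^-1 by lra.
  rewrite expRM_natl (_ : 16 = 2 ^+ 4) ?ler_pXn2r ?nnegrE ?expR_ge0//.
  by ring.
apply: (@le_lt_trans _ _ (transv x * 16)); first by rewrite ler_wpM2l ?transv_ge0.
lra.
Qed.

End Domain.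

(** * Pseudoconvexity and the limit function *)

Section DomainProperties.
Variables (R : realType) (n : nat) (i0 : 'I_n).
Local Notation CC := 'CC[R]_n.
Local Notation Omega := (@Omega R n i0).
Local Notation dfun := (dfun i0).
Local Notation transv := (transv i0).
Implicit Types (x y d : CC) (k : nat).

Lemma connected_segment (a b : CC) :
  connected ((fun t : R => a + (t%:C : R[i]^o) *: b) @` `[0, 1]%classic)%classic.
Proof.
apply: connected_continuous_connected; first exact: segment_connected.
apply: continuous_subspaceT => t; apply: continuous_affine.
by apply: continuous_Complex; [exact: cvg_id|exact: cvg_cst].
Qed.

(** The projection [(z, w) |-> (z, 0)]. *)
Definition axis_part x : CC := \row_i (if i == i0 then x 0 i else 0).

Lemma Omega_shrink x (t : R) : Omega x -> 0 <= t <= 1 ->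
  Omega (axis_part x + (t%:C : R[i]) *: (x - axis_part x)).
Proof.
move=> [k kx] /andP[t0 t1]; exists k; apply: le_lt_trans kx.
rewrite /dfun; apply: ler_pM; rewrite ?transv_ge0 ?expR_ge0//.
  rewrite /transv; apply: ler_sum => i ii0.
  rewrite !mxE (negbTE ii0) add0r subr0 sqmodM sqmod_real.
  by rewrite ler_piMl ?sqmod_ge0// exprn_ile1.
by rewrite !mxE eqxx subrr mulr0 addr0.
Qed.

Lemma Omega_axis_part x (t : R) : Omega ((t%:C : R[i]) *: axis_part x).
Proof.
apply: Omega_axis; rewrite transvZ (_ : transv _ = 0) ?mulr0//.
rewrite /transv big1// => i ii0; rewrite mxE (negbTE ii0).
by rewrite /sqmod/= expr0n addr0.
Qed.

Lemma Omega0 : Omega 0.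
Proof.
apply: Omega_axis; rewrite /transv big1// => i _.
by rewrite mxE /sqmod/= expr0n addr0.
Qed.

(** Every point is joined to its projection on the axis [w = 0], and this to the
    origin. *)
Lemma connected_Omega : connected Omega.
Proof.
pose seg a b := ((fun t : R => a + (t%:C : R[i]^o) *: b) @` `[0, 1])%classic : set CC.
pose S x := (seg (axis_part x) (x - axis_part x) `|` seg 0 (axis_part x))%classic.
have cS x : connected (S x).
  apply: connectedU; [|exact: connected_segment|exact: connected_segment].
  exists (axis_part x); split.
    exists 0; first by rewrite /= in_itv/= lexx ler01.
    by rewrite scale0r addr0.
  exists 1; first by rewrite /= in_itv/= lexx ler01.
  by rewrite scale1r add0r.
have -> : Omega = (\bigcup_(x in Omega) S x)%classic.
  apply/seteqP; split => [x Ox|y [x Ox] []].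
  - exists x => //; left; exists 1; first by rewrite /= in_itv/= lexx ler01.
    by rewrite scale1r addrC subrK.
  - by move=> [t]; rewrite /= in_itv/= => t01 <-; exact: Omega_shrink.
  - by move=> [t _ <-]; rewrite add0r; exact: Omega_axis_part.
apply: bigcup_connected => //.
exists 0 => x Ox; right; exists 0; first by rewrite /= in_itv/= lexx ler01.
by rewrite scale0r addr0.
Qed.

Lemma domain_Omega : domain Omega.
Proof.
by split; [exact: open_Omega|exact: connected_Omega|exists 0; exact: Omega0].
Qed.

(** Locally on [Omega] only finitely many of these functions are positive, since
    [k^2 (q - 1) + k] tends to [-oo] for [q < 1]; outside [Omega] they are
    unbounded. *)
Definition penalty k x : R := k%:R ^+ 2 * (dfun k x - 1) + k%:R.

Definition exhaustion x : R := sqnorm x + sup (range (fun k => penalty k x)).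

Lemma penalty0 x : penalty 0 x = 0.
Proof. by rewrite /penalty expr0n mul0r addr0. Qed.

Lemma continuous_penalty k x : {for x, continuous (penalty k)}.
Proof.
have c := contB (@continuous_dfun R n i0 k x) (@cont_cst _ _ x 1).
exact: contD (contM (@cont_cst _ _ x (k%:R ^+ 2)) c) (@cont_cst _ _ x k%:R).
Qed.

(** If [dfun K < q < 1] near [x], then [k^2 (q - 1) + k <= 0] as soon as
    [k >= 1 / (1 - q)]. *)
Lemma penalty_tail x : Omega x -> exists N, \forall y \near x,
  forall k, (N <= k)%N -> penalty k y <= 0.
Proof.
move=> [K Kx]; pose q := (dfun K x + 1) / 2.
have q1 : q < 1 by rewrite /q; lra.
have /(@dfun_near _ _ _ _ _ _) nq : dfun K x < q by rewrite /q; lra.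
exists (maxn K (Num.bound (1 - q)^-1)); apply: filterS nq => y yq k.
rewrite geq_max => /andP[Kk Bk].
have ky : dfun k y < q by apply: le_lt_trans yq; exact: dfun_decr.
have q0 : 0 < 1 - q by rewrite subr_gt0.
have k1 : 1 <= k%:R * (1 - q).
  rewrite -ler_pdivrMr// div1r; apply: le_trans (ltW (archi_boundP _)) _.
    by rewrite invr_ge0 ltW.
  by rewrite ler_nat.
rewrite /penalty.
have k0 : 0 <= k%:R :> R by [].
have : k%:R * (k%:R * (1 - dfun k y)) >= k%:R * 1.
  rewrite ler_wpM2l//; apply: le_trans k1 _; rewrite ler_wpM2l//; lra.
lra.
Qed.

Lemma has_sup_penalty_bound N x : (forall k, (N <= k)%N -> penalty k x <= 0) ->
  has_sup (range (fun k => penalty k x)).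
Proof.
move=> Nx; split; first by exists (penalty 0 x), 0%N.
exists (\sum_(j < N) `|penalty j x|) => _ [k _ <-].
have s0 : 0 <= \sum_(j < N) `|penalty j x| by apply: sumr_ge0 => j _; exact: normr_ge0.
have [kN|Nk] := ltnP k N; last exact: le_trans (Nx _ Nk) s0.
rewrite (bigD1 (Ordinal kN))//= (le_trans (ler_norm _))// lerDl.
by apply: sumr_ge0 => j _; exact: normr_ge0.
Qed.

Lemma has_sup_penalty x : Omega x -> has_sup (range (fun k => penalty k x)).
Proof.
by move=> /penalty_tail[N nx]; apply: has_sup_penalty_bound (nbhs_singleton nx).
Qed.

Lemma penalty_le_exhaustion k x : Omega x -> sqnorm x + penalty k x <= exhaustion x.
Proof.
move=> Ox; rewrite lerD2l; apply: ub_le_sup; last by exists k.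
by have [] := has_sup_penalty Ox.
Qed.

Lemma exhaustion_le x (c : R) : (forall k, sqnorm x + penalty k x <= c) ->
  exhaustion x <= c.
Proof.
move=> xc; rewrite /exhaustion -lerBrDl; apply: ge_sup.
  by exists (penalty 0 x), 0%N.
by move=> _ [k _ <-]; rewrite lerBrDl.
Qed.

Lemma continuous_sup_penalty x : Omega x ->
  {for x, continuous (fun y => sup (range (fun k => penalty k y)))}.
Proof.
move=> Ox; have [N nN] := penalty_tail Ox.
apply/(@cvgrPdist_le R R _ (nbhs x) _ _ _) => e e0.
have nk : \forall y \near x, forall k : 'I_N, `|penalty k x - penalty k y| < e.
  apply: (@filter_forall CC 'I_N (fun (k : 'I_N) (y : CC) => `|penalty k x - penalty k y| < e) (nbhs x)) => k.
  exact: ((@cvgrPdist_lt R R _ (nbhs x) _ (penalty k) (penalty k x)).1 (@continuous_penalty k x) e e0).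
near=> y.
have Ny : forall k, (N <= k)%N -> penalty k y <= 0 by near: y.
have ky : forall k : 'I_N, `|penalty k x - penalty k y| < e by near: y.
have Nx := nbhs_singleton nN.
have half (a b : CC) : (forall k, (N <= k)%N -> penalty k a <= 0) ->
    (forall k, (N <= k)%N -> penalty k b <= 0) ->
    (forall k : 'I_N, `|penalty k a - penalty k b| < e) ->
    sup (range (fun k => penalty k a)) <= sup (range (fun k => penalty k b)) + e.
  move=> Na Nb kab; apply: ge_sup; first by exists (penalty 0 a), 0%N.
  have ub k : penalty k b <= sup (range (fun k => penalty k b)).
    apply: ub_le_sup; last by exists k.
    by have [] := has_sup_penalty_bound Nb.
  move=> _ [k _ <-]; have [kN|Nk] := ltnP k N.
    have /ltr_normlP[h1 h2] := kab (Ordinal kN).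
    by have := ub k; rewrite /= in h1 h2; lra.
  by have := ub 0%N; rewrite penalty0; have := Na _ Nk; lra.
rewrite ler_distl; apply/andP; split.
  by rewrite lerBlDr half// => k; rewrite distrC.
exact: half.
Unshelve. all: by end_near. Qed.

Lemma continuous_exhaustion x : Omega x -> {for x, continuous exhaustion}.
Proof.
by move=> Ox; exact: contD (@continuous_sqnorm0 R n x) (continuous_sup_penalty Ox).
Qed.

Lemma continuous_circle_at (f : CC -> R) x d : (forall y, {for y, continuous f}) ->
  continuous (fun t : R => f (x + cis t *: d)).
Proof. by move=> cf; apply: continuous_circle. Qed.

Lemma mean_sqnorm x d : mean (fun t => sqnorm (x + cis t *: d)) = sqnorm x + sqnorm d.
Proof.
rewrite /sqnorm -big_split/= -(eq_bigr _ (fun i _ => mean_sqmod (x 0 i) (d 0 i))).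
rewrite -mean_sum; last by move=> i; exact: continuous_sqmod_circle.
by apply: eq_mean => t; apply: eq_bigr => i _; rewrite coord_circle.
Qed.

Lemma penalty_sub_mean k x d : penalty k x <= mean (fun t => penalty k (x + cis t *: d)).
Proof.
have cd := @continuous_circle_at _ x d (@continuous_dfun R n i0 k).
have c1 : continuous (fun t : R => k%:R ^+ 2 * dfun k (x + cis t *: d)).
  by move=> t; exact: contM (@cont_cst _ _ t _) (cd t).
have c2 : continuous (fun t : R => k%:R - k%:R ^+ 2 : R) by move=> t; exact: cvg_cst.
rewrite (@eq_mean _ _ (fun t => k%:R ^+ 2 * dfun k (x + cis t *: d) +
  (k%:R - k%:R ^+ 2))); last by move=> t; rewrite /penalty; ring.
rewrite (meanD c1 c2) meanZ// mean_cst /penalty.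
have := ler_wpM2l (sqr_ge0 (k%:R : R)) (dfun_sub_mean i0 k x d); lra.
Qed.

(** The closure of a sublevel set of the exhaustion still satisfies all the
    inequalities [k^2 (dfun k - 1) + k <= c], and these force [dfun k < 1] for
    [k > c]. *)
Lemma pseudoconvex_Omega : pseudoconvex Omega.
Proof.
exists exhaustion; split; first exact: continuous_exhaustion.
  apply: psh_continuous; first exact: continuous_exhaustion.
  move=> x d xd; apply: exhaustion_le => k.
  have cn := @continuous_circle_at _ x d (@continuous_sqnorm0 R n).
  have ce := @continuous_circle_at _ x d (@continuous_penalty k).
  apply: (@le_trans _ _ (mean (fun t => sqnorm (x + cis t *: d) + penalty k (x + cis t *: d)))).
    rewrite (meanD cn ce) mean_sqnorm lerD ?penalty_sub_mean//.
    by rewrite lerDl sqnorm_ge0.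
  apply: mean_le.
  - by move=> t; exact: contD (cn t) (ce t).
  - apply: continuous_circle => t; apply: continuous_exhaustion.
    exact: disc_circle.
  - by move=> t; apply: penalty_le_exhaustion; exact: disc_circle.
move=> c S.
pose T : set CC := ([set x : CC | sqnorm x <= c] `&`
  \bigcap_(k in [set: nat]) [set x | penalty k x <= c])%classic.
have closed_sub (f : CC -> R) : (forall x, {for x, continuous f}) ->
    closed [set x | f x <= c]%classic.
  move=> cf; apply: (@preimage_closed _ _ f [set r | r <= c]%classic).
    by move=> x _; exact: cf.
  exact: closed_le.
have cT : closed T.
  apply: closedI; first exact: closed_sub (@continuous_sqnorm0 R n).
  by apply: closed_bigI => k _; apply: closed_sub => x; exact: continuous_penalty.
have kT : compact T.
  by apply: subclosed_compact cT (@compact_sqnorm R n c) _ => x [].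
have ST : S `<=` T.
  rewrite ((closure_id T).1 cT); apply: closureS => x [Ox xc].
  split => /=.
    apply: le_trans (ltW xc); have := penalty_le_exhaustion 0 Ox.
    by rewrite penalty0 addr0.
  move=> k _ /=; apply: le_trans (ltW xc); apply: le_trans (penalty_le_exhaustion k Ox).
  by rewrite lerDr sqnorm_ge0.
split; first exact: subclosed_compact (@closed_closure _ _) kT ST.
move=> x /ST[_ xT].
pose k := (Num.bound `|c|).+1.
have ck : c < k%:R.
  apply: le_lt_trans (ler_norm c) _; apply: lt_trans (archi_boundP (normr_ge0 c)) _.
  by rewrite ltr_nat.
exists k; have := xT k I; rewrite /= /penalty => h.
have k0 : 0 < k%:R ^+ 2 :> R by rewrite exprn_gt0// ltr0n.
by rewrite -subr_lt0 -(pmulr_rlt0 _ k0); lra.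
Qed.

Lemma dfun_lim_near x (a : R) : dfun_lim i0 x < a ->
  \forall y \near x, dfun_lim i0 y < a.
Proof.
move=> /dfun_lim_lt[k ka]; apply: filterS (dfun_near ka) => y.
by apply: le_lt_trans; exact: dfun_lim_le.
Qed.

(** A decreasing limit of continuous functions is upper semicontinuous, and its
    submean inequalities follow by dominated convergence. The summand [g] leaves
    room for the constant [-1] and for test functions. *)
Lemma psh_dfun_lim (U : set CC) (g : CC -> R) :
  (forall x, U x -> {for x, continuous g}) ->
  (forall k x d, disc_in U x d ->
     dfun k x + g x <= mean (fun t => dfun k (x + cis t *: d) + g (x + cis t *: d))) ->
  psh U (fun x => (dfun_lim i0 x + g x)%:E).
Proof.
move=> cg sub; apply: psh_intro.
- by move=> z _; rewrite ltry.
- move=> z Uz a; rewrite lte_fin => za.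
  pose e := (a - dfun_lim i0 z - g z) / 2.
  have e0 : 0 < e by rewrite /e; lra.
  have n1 := @dfun_lim_near z (dfun_lim i0 z + e) ltac:(lra).
  have n2 : \forall w \near z, `|g z - g w| < e.
    exact: ((@cvgrPdist_lt R R _ (nbhs z) _ g (g z)).1 (cg z Uz) e e0).
  near=> w; rewrite lte_fin.
  have h1 : dfun_lim i0 w < dfun_lim i0 z + e by near: w.
  have /ltr_normlP[h2 h3] : `|g z - g w| < e by near: w.
  by rewrite /e in h1 h2; lra.
- move=> x d xd.
  have cgc : continuous (fun t : R => g (x + cis t *: d)).
    by apply: continuous_circle => t; apply: cg; exact: disc_circle.
  pose u k t := dfun k (x + cis t *: d) + g (x + cis t *: d).
  apply: (@mean_limit_ge R u (fun t => dfun_lim i0 (x + cis t *: d) + g (x + cis t *: d))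
    (fun t => g (x + cis t *: d))) => //.
  + move=> k t; apply: contD (cgc t).
    exact: (@continuous_circle_at _ x d (@continuous_dfun R n i0 k)).
  + by move=> t k; rewrite lerD2r dfun_decrS.
  + by move=> t k; rewrite lerDr dfun_ge0.
  + by move=> t; apply: cvgD; [exact: cvg_dfun|exact: cvg_cst].
  + by move=> k; apply: le_trans (sub k x d xd); rewrite lerD2r dfun_lim_le.
Unshelve. all: by end_near. Qed.

Definition phi_star x : \bar R := (dfun_lim i0 x - 1)%:E.

Lemma phi_star_PSH : PSH_star Omega phi_star.
Proof.
split.
  apply: (@psh_dfun_lim Omega (fun=> -1)) => [x _|k x d _]; first exact: cont_cst.
  rewrite (meanD (@continuous_circle_at _ x d (@continuous_dfun R n i0 k))).
    by rewrite mean_cst lerD2r dfun_sub_mean.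
  by move=> t; exact: cvg_cst.
move=> z Oz; exists 1; have /OmegaP/dfun_lim_near := Oz.
apply: filterS => y y1; rewrite lee_fin ler_norml.
by have := dfun_lim_ge0 i0 y => ?; apply/andP; split; lra.
Qed.

Lemma phi_star_lt0 x : Omega x -> (phi_star x < 0)%E.
Proof. by move=> /OmegaP x1; rewrite lte_fin subr_lt0. Qed.

End DomainProperties.

(** * Rigidity of continuous functions *)

Section Rigidity.
Variables (R : realType) (n : nat) (i0 : 'I_n).
Local Notation CC := 'CC[R]_n.
Local Notation C := (R[i]^o).
Local Notation Omega := (@Omega R n i0).
Local Notation transv := (transv i0).
Local Notation axis_part := (axis_part i0).
Local Notation e0 := (delta_mx 0 i0 : CC).

Lemma axis_partE (x : CC) : axis_part x = x 0 i0 *: e0.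
Proof.
apply/rowP => i; rewrite !mxE eqxx/=.
by case: eqP => [->|_]; rewrite ?mulr1 ?mulr0.
Qed.

Lemma coord_add_axis (x : CC) (z : R[i]) : (x - axis_part x + z *: e0) 0 i0 = z.
Proof. by rewrite !mxE !eqxx subrr add0r mulr1. Qed.

Lemma transv_add_axis (x : CC) (z : R[i]) :
  transv (x - axis_part x + z *: e0) = transv x.
Proof.
apply: eq_bigr => i ii0; rewrite !mxE (negbTE ii0) eqxx/= mulr0 addr0.
by rewrite subr0.
Qed.

Lemma coord_axis_add (x : CC) (z : R[i]) :
  (axis_part x + z *: (x - axis_part x)) 0 i0 = x 0 i0.
Proof. by rewrite !mxE eqxx subrr mulr0 addr0. Qed.

Lemma transv_axis_add (x : CC) (z : R[i]) :
  transv (axis_part x + z *: (x - axis_part x)) = sqmod z * transv x.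
Proof.
rewrite -transvZ; apply: eq_bigr => i ii0; rewrite !mxE (negbTE ii0) add0r.
by rewrite subr0.
Qed.

Lemma continuous_real_dense (g : R -> R) (c : R) : continuous g ->
  (forall q : rat, g (ratr q) = c) -> forall t, g t = c.
Proof.
move=> cg gq t; apply/eqP; rewrite -subr_eq0 -normr_le0 leNgt; apply/negP => e0.
have nt : \forall y \near t, `|g t - g y| < `|g t - c|.
  exact: ((@cvgrPdist_lt R R _ (nbhs t) _ g (g t)).1 (cg t) _ e0).
have /nbhs_ballP[d d0 dP] := nt.
have td : t < t + d by rewrite ltrDl.
have [q] := rat_in_itvoo td; rewrite in_itv/= => /andP[tq qd].
have : ball t d (ratr q : R).
  by rewrite -ball_normE/= distrC gtr0_norm ?subr_gt0//; lra.
by move=> /dP; rewrite /= gq ltxx.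
Qed.

(** A continuous plurisubharmonic function bounded above is constant by Liouville's
    theorem on the line [w = 0] and on the lines that meet it and lie in some
    subspace [z = pole j]; continuity carries
    the constant [c] over to [|z| = 1], the maximum principle on the discs
    [w = const] makes [c] an upper bound for [|z| <= 1], and this bound is
    attained at the centres of the discs [z = const]. *)
Lemma constant_cylinder (phi : CC -> \bar R) : PSH_zero Omega phi ->
  bounded_above_on Omega phi ->
  exists c : R, forall x : CC, sqmod (x 0 i0) <= 1 -> transv x < 16^-1 -> phi x = c%:E.
Proof.
move=> [pphi cphi] [A phiA].
pose f (x : CC) := fine (phi x).
have cf x : Omega x -> {for x, continuous f}.
  by move=> /(continuous_real_fine cphi)[].
have phiE x : Omega x -> phi x = (f x)%:E.
  by move=> /(continuous_real_fine cphi)[].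
have sub : sub_mean Omega f by exact: sub_mean_fine.
have fA x : Omega x -> f x <= A.
  by move=> Ox; have := phiA x Ox; rewrite phiE// lee_fin.
pose c := f 0; exists c.
have axis x : f (axis_part x) = c.
  rewrite axis_partE -[_ *: _]add0r.
  apply: (liouville_line cf sub fA) => z.
  rewrite add0r; apply: Omega_axis; rewrite transvZ (_ : transv _ = 0) ?mulr0//.
  rewrite /transv big1// => i ii0; rewrite mxE (negbTE ii0) andbF.
  by rewrite /sqmod/= expr0n addr0.
have pole_line (x : CC) j : x 0 i0 = pole R j -> f x = c.
  move=> xj; rewrite -(axis x).
  have := @liouville_line _ _ _ _ (axis_part x) (x - axis_part x) _ cf sub fA _ 1.
  rewrite scale1r [axis_part x + _]addrC subrK; apply => z.
  by apply: (@Omega_pole _ _ _ _ j); rewrite coord_axis_add.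
have circle (x : CC) t : transv x < 16^-1 -> x 0 i0 = cis t -> f x = c.
  move=> x16 xt.
  have E s : f (x - axis_part x + cis s *: e0) = c.
    apply: (@continuous_real_dense (fun s => f (x - axis_part x + cis s *: e0))).
      apply: continuous_circle => u; apply: cf; apply: Omega_cylinder.
        by rewrite coord_add_axis sqmod_cis.
      by rewrite transv_add_axis.
    move=> q; have [j qj] := pole_dense R q.
    by apply: (@pole_line _ j); rewrite coord_add_axis.
  have := E t; rewrite -xt.
  by rewrite -axis_partE subrK.
have upper (x : CC) : sqmod (x 0 i0) <= 1 -> transv x < 16^-1 -> f x <= c.
  move=> x1 x16.
  have inO (z : C) : sqmod z <= 1 -> Omega (x - axis_part x + z *: e0).
    move=> z1; apply: Omega_cylinder; first by rewrite coord_add_axis.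
    by rewrite transv_add_axis.
  pose u (z : C) := f (x - axis_part x + z *: e0).
  have -> : f x = u (x 0 i0) by rewrite /u -axis_partE subrK.
  apply: (@maximum_principle R [set z : C | sqmod z <= 1]%classic
    (fun z => 1 <= sqmod z) u c) => //.
  - exact: compact_sqmod.
  - move=> z z1; have ca := @continuous_affine R n _ (fun z : C => z) z
      (x - axis_part x) e0 (@cvg_id _ _).
    exact: (continuous_comp ca (cf _ (inO z z1))).
  - move=> z z1 z1'; have : sqmod z = 1 by apply: le_anti; rewrite z1.
    move=> /cis_surj[t zt]; rewrite /u (@circle _ t)//.
      by rewrite transv_add_axis.
    by rewrite coord_add_axis.
  - move=> z _ /negP; rewrite -ltNge => z1.
    have nz : \forall y \near (z : C), sqmod y < 1.
      have op : open [set y : C | sqmod y < 1]%classic.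
        apply: (@open_comp C R (@sqmod R : C -> R) [set r | r < 1]%classic).
          by move=> y _; exact: continuous_sqmod.
        exact: open_lt.
      by apply: open_nbhs_nbhs; split; [exact: op|].
    have [r [r0 rP]] := (near_sqmod z _).1 nz.
    pose d : C := (r / 2)%:C.
    have dr : sqmod d < r ^+ 2 by rewrite sqmod_real; nra.
    have zd (v : R[i]) : sqmod v <= 1 -> sqmod (z + v * d) <= 1.
      move=> v1; apply/ltW/rP; rewrite addrAC subrr add0r sqmodM.
      by apply: le_lt_trans dr; rewrite ler_piMl ?sqmod_ge0.
    exists d; split.
    + by rewrite -sqmod_eq0 sqmod_real expf_eq0/= gt_eqF ?divr_gt0.
    + by move=> t; rewrite /= mulrC zd ?sqmod_cis.
    + apply: (@sub_mean_line _ _ _ f (x - axis_part x) e0 z d sub) => v v1.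
      by rewrite -addrA scalerA -scalerDl; apply: inO; exact: zd.
move=> x x1 x16.
have Ox : Omega x by exact: Omega_cylinder.
rewrite phiE//; congr EFin.
have E (v : R[i]) : axis_part x + v *: - (x - axis_part x) =
    axis_part x + (- v) *: (x - axis_part x) by rewrite scalerN scaleNr.
have := @strong_maximum_disc _ _ Omega f (axis_part x) (- (x - axis_part x)) c cf sub.
rewrite opprK [axis_part x + (x - _)]addrC subrK; apply.
- move=> v v1; rewrite E; apply: Omega_cylinder; rewrite ?coord_axis_add//.
  rewrite transv_axis_add sqmodN; apply: le_lt_trans x16.
  by rewrite ler_piMl ?transv_ge0.
- move=> t; rewrite E; apply: upper; rewrite ?coord_axis_add//.
  by rewrite transv_axis_add sqmodN sqmod_cis mul1r.
- by rewrite axis.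
Qed.

End Rigidity.

(** * Second differences of smooth functions *)

Section SecondDifference.
Variables (R : realType) (n : nat).
Local Notation CC := 'CC[R]_n.
Implicit Types (g : CC -> R) (x y z v : CC) (l : seq (R * CC)).

Definition ddir g v x : R := derive1 (real_line g x v) 0.
Definition has_ddir g v : Prop := forall x, derivable (real_line g x v) 0 1.

Lemma is_derive_real_line g v x (t : R) : has_ddir g v ->
  is_derive t 1 (real_line g x v) (ddir g v (x + (t%:C : R[i]) *: v)).
Proof.
move=> dg.
have E : real_line g x v =
    (fun s : R => real_line g (x + (t%:C : R[i]) *: v) v (s + - t)).
  apply/funext => s; rewrite /real_line -addrA -scalerDl; congr (g (x + _ *: v)).
  by rewrite -rmorphD/= addrC subrK.
have dgt := dg (x + (t%:C : R[i]) *: v).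
rewrite {1}E; apply: is_derive_comp_translate; rewrite subrr /ddir derive1E.
exact: DeriveDef.
Qed.

(** Rescaling the segment from [x] to [x + c *: v] to the unit interval lets the
    mean value theorem be applied with bounds that are uniform in [c]. *)
Lemma is_derive_step g v x (c t : R) : has_ddir g v ->
  is_derive t 1 (fun s : R => g (x + ((s * c)%:C : R[i]) *: v))
    (c * ddir g v (x + ((t * c)%:C : R[i]) *: v)).
Proof.
move=> dg; have d1 := is_derive_real_line x (t * c) dg.
have d2 : is_derive t 1 (fun s : R => s * c) c.
  by rewrite (_ : (fun s : R => s * c) = (fun s : R => c * s));
    [exact: is_derive_scale|apply/funext => s; rewrite mulrC].
by rewrite mulrC; exact: (@is_derive1_comp _ (real_line g x v) (fun s => s * c) t _ _ d1 d2).
Qed.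

Lemma increment_le (h dh : R -> R) (M : R) : (forall t : R, is_derive t 1 h (dh t)) ->
  (forall t, 0 <= t <= 1 -> `|dh t| <= M) -> `|h 1 - h 0| <= M.
Proof.
move=> hd dM; have ch : {within `[0, 1], continuous h}.
  by apply: continuous_subspaceT => t; exact: derive_continuous_at (hd t).
have [t t01 ->] := @MVT _ h dh 0 1 ltr01 (fun t _ => hd t) ch.
rewrite subr0 mulr1; apply: dM; move: t01; rewrite in_itv/= => /andP[t0 t1].
by rewrite !ltW.
Qed.

Definition lincomb l : CC := \sum_(p <- l) (p.1%:C : R[i]) *: p.2.
Definition norm1 l : R := \sum_(p <- l) `|p.1|.

Lemma norm1_ge0 l : 0 <= norm1 l.
Proof. by apply: sumr_ge0 => p _; exact: normr_ge0. Qed.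

Variable V : seq CC.

(** The increment is split into steps along one vector of [V] at a time, so that
    only the derivatives along these finitely many vectors need a bound. *)
Lemma lipschitz_lincomb g (M : R) : (forall v, v \in V -> has_ddir g v) ->
  (forall v x, v \in V -> `|ddir g v x| <= M) ->
  forall l x, all (fun p => p.2 \in V) l -> `|g (x + lincomb l) - g x| <= M * norm1 l.
Proof.
move=> dg gM; elim=> [|[c v] l IH] x /=.
  by rewrite /lincomb /norm1 !big_nil addr0 subrr normr0 mulr0.
move=> /andP[vV lV]; rewrite /lincomb /norm1 !big_cons/= -/(lincomb l) -/(norm1 l).
have step : `|g (x + (c%:C : R[i]) *: v) - g x| <= M * `|c|.
  have := @increment_le _ _ (M * `|c|) (fun t => is_derive_step x c t (dg v vV)).
  rewrite mul1r mul0r scale0r addr0; apply => t _.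
  by rewrite normrM mulrC ler_wpM2r// gM.
have := IH (x + (c%:C : R[i]) *: v) lV; rewrite -addrA => step'.
rewrite (_ : g _ - g x = (g (x + ((c%:C : R[i]) *: v + lincomb l)) - g (x + (c%:C : R[i]) *: v)) +
  (g (x + (c%:C : R[i]) *: v) - g x)); last by ring.
apply: le_trans (ler_normD _ _) _; rewrite mulrDr; lra.
Qed.

(** A step along [c *: v] moves the two points [z + l'] and [z - l'] in opposite
    directions, so the increment of the sum involves a difference of first
    derivatives at points that differ by twice the displacement; this is bounded
    by [lipschitz_lincomb]. The displacement [l'] already made is the induction
    parameter. *)
Lemma second_difference_lincomb g (M : R) : 0 <= M ->
  (forall v, v \in V -> has_ddir g v) ->
  (forall u v, u \in V -> v \in V -> has_ddir (ddir g u) v) ->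
  (forall u v x, u \in V -> v \in V -> `|ddir (ddir g u) v x| <= M) ->
  forall l l' z, all (fun p => p.2 \in V) l -> all (fun p => p.2 \in V) l' ->
  `|g (z + lincomb l' + lincomb l) + g (z - lincomb l' - lincomb l) -
    (g (z + lincomb l') + g (z - lincomb l'))| <=
  2 * M * (norm1 l' + norm1 l) * norm1 l.
Proof.
move=> M0 dg ddg gM; elim=> [|[c v] l IH] l' z /=.
  by rewrite /lincomb /norm1 !big_nil !addr0 subr0 subrr normr0 mulr0.
move=> /andP[vV lV] l'V.
have T : lincomb ((c, v) :: l) = (c%:C : R[i]) *: v + lincomb l by rewrite /lincomb big_cons.
have T' : lincomb ((c, v) :: l') = (c%:C : R[i]) *: v + lincomb l' by rewrite /lincomb big_cons.
have NN : norm1 ((c, v) :: l) = `|c| + norm1 l by rewrite /norm1 big_cons.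
have NN' : norm1 ((c, v) :: l') = `|c| + norm1 l' by rewrite /norm1 big_cons.
have := IH ((c, v) :: l') z lV; rewrite /= vV l'V => /(_ isT).
rewrite T T' NN NN' => IH1.
set a := z + lincomb l'; set b := z - lincomb l'.
have Ea : z + ((c%:C : R[i]) *: v + lincomb l') = a + (c%:C : R[i]) *: v.
  by rewrite /a -addrA [lincomb l' + _]addrC.
have Eb : z - ((c%:C : R[i]) *: v + lincomb l') = b + ((- c)%:C : R[i]) *: v.
  by rewrite /b opprD -addrA [- lincomb l' + _]addrC rmorphN scaleNr.
rewrite Ea Eb in IH1.
have step : `|(g (a + (c%:C : R[i]) *: v) + g (b + ((- c)%:C : R[i]) *: v)) - (g a + g b)| <=
    2 * M * (norm1 l' + `|c|) * `|c|.
  have d (t : R) : is_derive t 1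
      (fun s : R => g (a + ((s * c)%:C : R[i]) *: v) + g (b + ((s * - c)%:C : R[i]) *: v))
      (c * ddir g v (a + ((t * c)%:C : R[i]) *: v) +
       - c * ddir g v (b + ((t * - c)%:C : R[i]) *: v)).
    by apply: is_deriveD; exact: is_derive_step (dg v vV).
  have := @increment_le _ _ (2 * M * (norm1 l' + `|c|) * `|c|) d.
  rewrite !mul1r !mul0r !scale0r !addr0; apply => t /andP[t0 t1].
  rewrite mulNr -mulrBr normrM mulrC ler_wpM2r//.
  pose l2 := [seq (2 * p.1, p.2) | p <- (t * c, v) :: l'].
  have T2 : lincomb l2 = (2%:R : R[i]) *: (((t * c)%:C : R[i]) *: v + lincomb l').
    rewrite /l2 /lincomb big_map big_cons/= scalerDr scalerA.
    congr (_ + _); first by rewrite rmorphM rmorph_nat.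
    by rewrite scaler_sumr; apply: eq_bigr => p _; rewrite scalerA rmorphM rmorph_nat.
  have N2 : norm1 l2 = 2 * (`|t * c| + norm1 l').
    rewrite /l2 /norm1 big_map big_cons/= mulrDr normrM ger0_norm//.
    by congr (_ + _); rewrite mulr_sumr; apply: eq_bigr => p _; rewrite normrM ger0_norm.
  have := @lipschitz_lincomb (ddir g v) M (fun u uV => ddg v u vV uV)
    (fun u x uV => gM v u x vV uV) l2 (b + ((t * - c)%:C : R[i]) *: v).
  have -> : b + ((t * - c)%:C : R[i]) *: v + lincomb l2 = a + ((t * c)%:C : R[i]) *: v.
    rewrite T2 /a /b mulrN rmorphN/= scaleNr scaler_nat mulr2n.
    set s := _ *: v; set q := lincomb l'.
    rewrite -!addrA; congr (z + _).
    by rewrite !addKr addrC.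
  rewrite N2 => /(_ _) H; apply: le_trans (H _) _.
    apply/allP => p /mapP[p' p'l ->] /=.
    by move: p'l; rewrite inE => /orP[/eqP -> //|/(allP l'V)].
  rewrite mulrCA -mulrA ler_wpM2l// ler_wpM2l// addrC lerD2l normrM ger0_norm//.
  by rewrite ler_piMl.
have NL := norm1_ge0 l; have NL' := norm1_ge0 l'; have c0 := normr_ge0 c.
set A := g _ + g _ in IH1; set B := g _ + g _ in IH1 step; set D := g a + g b in step *.
have -> : a + ((c%:C : R[i]) *: v + lincomb l) = a + (c%:C : R[i]) *: v + lincomb l by rewrite addrA.
have -> : b - ((c%:C : R[i]) *: v + lincomb l) = b + ((- c)%:C : R[i]) *: v - lincomb l.
  by rewrite opprD addrA rmorphN scaleNr.
rewrite -/A (_ : A - D = (A - B) + (B - D)); last by ring.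
apply: le_trans (ler_normD _ _) _.
have : 0 <= 2 * M * norm1 l * `|c| by rewrite !mulr_ge0.
lra.
Qed.

End SecondDifference.

(** * Circle means of test functions *)

Section TestFunctions.
Variables (R : realType) (n : nat).
Local Notation CC := 'CC[R]_n.
Implicit Types (g f : CC -> R) (x y z v d : CC) (U S : set CC).

(** Coordinates of [x] in the basis of [C^n] over the reals made of the [e_i] and
    the [i e_i]. *)
Definition real_coords x : seq (R * CC) :=
  [seq (Re (x 0 i), delta_mx 0 i : CC) | i <- index_enum 'I_n] ++
  [seq (Im (x 0 i), ('i%C : R[i]) *: (delta_mx 0 i : CC)) | i <- index_enum 'I_n].

Definition real_dirs : seq CC :=
  [seq (delta_mx 0 i : CC) | i <- index_enum 'I_n] ++
  [seq ('i%C : R[i]) *: (delta_mx 0 i : CC) | i <- index_enum 'I_n].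

Lemma real_coords_dirs x : all (fun p => p.2 \in real_dirs) (real_coords x).
Proof.
rewrite all_cat !all_map; apply/andP; split; apply/allP => i i_in /=;
  rewrite mem_cat; apply/orP; [left|right]; apply/mapP; exists i; rewrite ?mem_index_enum//.
Qed.

Lemma lincomb_real_coords x : lincomb (real_coords x) = x.
Proof.
rewrite /lincomb /real_coords big_cat/= !big_map/= -big_split/=.
apply/rowP => j; rewrite summxE (bigD1 j)//= big1 ?addr0.
  rewrite !mxE !eqxx/= !mulr1; case: (x 0 j) => a b /=.
  by apply/eqP; rewrite eq_complex/=; apply/andP; split; apply/eqP; ring.
by move=> i ij; rewrite !mxE eqxx/= eq_sym (negbTE ij)/= !mulr0 addr0.
Qed.

Lemma norm1_real_coords x : norm1 (real_coords x) ^+ 2 <= (2 * n%:R) ^+ 2 * sqnorm x.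
Proof.
pose s := Num.sqrt (sqnorm x).
have s2 : s ^+ 2 = sqnorm x by rewrite sqr_sqrtr ?sqnorm_ge0.
have s0 : 0 <= s by exact: sqrtr_ge0.
rewrite -s2 -exprMn ler_sqr ?nnegrE ?norm1_ge0 ?mulr_ge0//.
have le_s (a : R) i : a ^+ 2 <= sqmod (x 0 i) -> `|a| <= s.
  move=> h; rewrite -ler_sqr ?nnegrE// real_normK ?num_real// s2.
  exact: le_trans h (sqmod_le_sqnorm x i).
rewrite /norm1 /real_coords big_cat/= !big_map/= -big_split/=.
apply: (@le_trans _ _ (\sum_(i < n) (2 * s))).
  apply: ler_sum => i _.
  have h1 := le_s (Re (x 0 i)) i ltac:(by rewrite /sqmod lerDl sqr_ge0).
  have h2 := le_s (Im (x 0 i)) i ltac:(by rewrite /sqmod lerDr sqr_ge0).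
  lra.
by rewrite sumr_const card_ord -mulr_natr; lra.
Qed.

Lemma second_difference_le g :
  (forall v, has_ddir g v) -> (forall u v, has_ddir (ddir g u) v) ->
  (forall u v, exists M : R, forall x, `|ddir (ddir g u) v x| <= M) ->
  exists K : R, 0 <= K /\
    forall z h, `|g (z + h) + g (z - h) - 2 * g z| <= K * sqnorm h.
Proof.
move=> dg ddg bd.
have [M [M0 gM]] : exists M : R, 0 <= M /\ forall u v x, u \in real_dirs ->
    v \in real_dirs -> `|ddir (ddir g u) v x| <= M.
  have : forall s t : seq CC, exists M : R, 0 <= M /\ forall u v x, u \in s ->
    v \in t -> `|ddir (ddir g u) v x| <= M.
    elim=> [|u s IH] t; first by exists 0; split.
    have [M1 [M10 H1]] := IH t.
    have [M2 [M20 H2]] : exists M : R, 0 <= M /\ forall v x, v \in t ->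
        `|ddir (ddir g u) v x| <= M.
      elim: t {IH M1 M10 H1} => [|v t [M [M0 H]]]; first by exists 0; split.
      have [M' H'] := bd u v.
      exists (M + `|M'|); split; first by rewrite addr_ge0.
      move=> w x; rewrite inE => /orP[/eqP ->|wt].
        by apply: le_trans (H' x) _; have := ler_norm M'; lra.
      by apply: le_trans (H _ _ wt) _; rewrite lerDl.
    exists (M1 + M2); split; first by rewrite addr_ge0.
    move=> w v x; rewrite inE => /orP[/eqP ->|ws] vt.
      by apply: le_trans (H2 _ _ vt) _; rewrite lerDr.
    by apply: le_trans (H1 _ _ _ ws vt) _; rewrite lerDl.
  exact.
exists (2 * M * (2 * n%:R) ^+ 2); split.
  by rewrite !mulr_ge0.
move=> z h.
have := @second_difference_lincomb R n real_dirs g M M0 (fun v _ => dg v)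
  (fun u v _ _ => ddg u v) gM (real_coords h) [::] z (real_coords_dirs h) isT.
have T0 : lincomb ([::] : seq (R * CC)) = 0 by rewrite /lincomb big_nil.
have N0 : norm1 ([::] : seq (R * CC)) = 0 by rewrite /norm1 big_nil.
rewrite T0 N0 addr0 subr0 add0r lincomb_real_coords -[g z + g z]mulr2n -(mulr_natl (g z)).
rewrite -[X in _ <= X]mulrA -expr2 => H; apply: le_trans H _.
by rewrite -[leRHS]mulrA ler_wpM2l ?norm1_real_coords// mulr_ge0.
Qed.

(** Extended by zero, a test function has bounded derivatives on the whole space,
    in which segments cannot leave the domain. *)
Definition extend0 U g : CC -> R := fun x => if `[< U x >] then g x else 0.

Lemma extend0_in U g x : U x -> extend0 U g x = g x.
Proof. by move=> Ux; rewrite /extend0 asboolT. Qed.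

Lemma near_real_line x v (P : CC -> Prop) : (\forall y \near x, P y) ->
  \forall t \near (0 : R), P (x + (t%:C : R[i]^o) *: v).
Proof.
move=> nP.
have c : {for (0 : R), continuous (fun t : R => x + (t%:C : R[i]^o) *: v)}.
  apply: continuous_affine; apply: continuous_Complex; [exact: cvg_id|exact: cvg_cst].
by apply: c; rewrite scale0r addr0.
Qed.

(** Every point has a neighbourhood contained in the open set [U] or in the
    complement of the closed set [S], so the extension is differentiable and the
    derivative is the extension of the derivative. *)
Section ExtendDerivative.
Variables (U S : set CC) (g : CC -> R) (v : CC).
Hypotheses (oU : open U) (cS : closed S) (SU : (S `<=` U)%classic)
  (gS : forall x, U x -> g x != 0 -> S x).

Lemma near_notin x : ~ S x -> \forall y \near x, ~ S y.
Proof. by move=> Sx; apply: open_nbhs_nbhs; split => //; exact: closed_openC. Qed.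

Lemma extend0_notin x : ~ S x -> extend0 U g x = 0.
Proof.
move=> Sx; rewrite /extend0; case: asboolP => // Ux.
by apply/eqP/negPn/negP => /(gS Ux).
Qed.

Hypothesis dg : forall x, U x -> derivable (real_line g x v) 0 1.

Lemma extend0_real_line x :
  (U x -> \forall t \near (0 : R), real_line (extend0 U g) x v t = real_line g x v t) /\
  (~ S x -> \forall t \near (0 : R), real_line (extend0 U g) x v t = cst 0 t).
Proof.
split=> [Ux|Sx].
  have nU : \forall y \near x, U y by apply: open_nbhs_nbhs.
  by apply: filterS (near_real_line v nU) => t Ut; exact: extend0_in.
by apply: filterS (near_real_line v (near_notin Sx)) => t St; exact: extend0_notin.
Qed.

Lemma ddir_eq0 x : U x -> ~ S x -> ddir g v x = 0.
Proof.
move=> Ux Sx; have [/(_ Ux) h1 /(_ Sx) h2] := extend0_real_line x.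
have : \forall t \near (0 : R), real_line g x v t = cst 0 t.
  by apply: filterS2 h1 h2 => t <- ->.
move=> /(@near_eq_derive R R R _ _ 0 1) E.
by rewrite /ddir derive1E E derive_cst.
Qed.

Lemma has_ddir_extend0 : has_ddir (extend0 U g) v.
Proof.
move=> x; have [h1 h2] := extend0_real_line x.
have [Ux|Ux] := pselect (U x).
  have E : \forall t \near (0 : R), real_line g x v t = real_line (extend0 U g) x v t.
    by apply: filterS (h1 Ux) => t ->.
  exact: (near_eq_derivable E) (dg Ux).
have Sx : ~ S x by move=> /SU.
have E : \forall t \near (0 : R), cst 0 t = real_line (extend0 U g) x v t.
  by apply: filterS (h2 Sx) => t ->.
apply: (near_eq_derivable E); exact: derivable_cst.
Qed.

Lemma ddir_extend0 : ddir (extend0 U g) v = extend0 U (ddir g v).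
Proof.
apply/funext => x; have [h1 h2] := extend0_real_line x.
rewrite {2}/extend0; case: asboolP => Ux.
  by rewrite /ddir !derive1E; apply: near_eq_derive; exact: h1.
have Sx : ~ S x by move=> /SU.
have := @near_eq_derive R R R _ _ 0 1 (h2 Sx).
by rewrite /ddir derive1E => ->; rewrite derive_cst.
Qed.

Lemma ddir_supp x : U x -> ddir g v x != 0 -> S x.
Proof.
move=> Ux; apply: contraNP => Sx.
by rewrite ddir_eq0.
Qed.

End ExtendDerivative.

Lemma extend0_bounded U S g : compact S -> (S `<=` U)%classic ->
  (forall x, U x -> g x != 0 -> S x) -> (forall x, U x -> {for x, continuous g}) ->
  exists M : R, forall x, `|extend0 U g x| <= M.
Proof.
move=> kS SU gS cg.
have [S0|S0] := pselect (S !=set0)%classic; last first.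
  exists 0 => x; rewrite (@extend0_notin U S g gS) ?normr0// => Sx.
  by apply: S0; exists x.
have cn x : x \in S -> {for x, continuous (fun y => `|g y|)}.
  by move=> /set_mem/SU/cg cgx; exact: cvg_norm cgx.
have [p _ pmax] := compact_EVT_max S0 kS (continuous_in_subspaceT cn).
exists `|g p| => x; have [Sx|Sx] := pselect (S x).
  by rewrite extend0_in; [apply: pmax; exact: mem_set|exact: SU].
by rewrite (@extend0_notin U S g gS)// normr0.
Qed.

(** Antipodal points of the circle contribute together a second difference, which
    is quadratic in [d]. *)
Lemma mean_test_function U theta : open U -> smooth_on U theta ->
  compact_support_in U theta ->
  exists K : R, 0 <= K /\ forall x d, disc_in U x d ->
    `|mean (fun t => theta (x + cis t *: d)) - theta x| <= K * sqnorm d.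
Proof.
move=> oU sm [kS SU]; set S := closure _ in kS SU.
have cS : closed S by exact: closed_closure.
have gS x : U x -> theta x != 0 -> S x by move=> Ux tx; apply: subset_closure.
have [c0 /= D1] := sm 2%N.
have d1 v x : U x -> derivable (real_line theta x v) 0 1 by have [+ _] := D1 v; apply.
have d2 u v x : U x -> derivable (real_line (ddir theta u) x v) 0 1.
  by have [_ [_ D2]] := D1 u; have [+ _] := D2 v; apply.
have c2 u v x : U x -> {for x, continuous (ddir (ddir theta u) v)}.
  by have [_ [_ D2]] := D1 u; have [_ [+ _]] := D2 v; apply.
pose g := extend0 U theta.
have gS1 u x : U x -> ddir theta u x != 0 -> S x.
  exact: (ddir_supp oU cS gS).
have gS2 u v x : U x -> ddir (ddir theta u) v x != 0 -> S x.
  exact: (ddir_supp oU cS (gS1 u)).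
have dg v : has_ddir g v by exact: (has_ddir_extend0 oU cS SU gS (d1 v)).
have gE u : ddir g u = extend0 U (ddir theta u).
  exact: (ddir_extend0 u oU cS SU gS).
have ddg u v : has_ddir (ddir g u) v.
  by rewrite gE; exact: (has_ddir_extend0 oU cS SU (gS1 u) (d2 u v)).
have bd u v : exists M : R, forall x, `|ddir (ddir g u) v x| <= M.
  rewrite gE (ddir_extend0 v oU cS SU (gS1 u)).
  exact: (extend0_bounded kS SU (gS2 u v) (c2 u v)).
have [K [K0 HK]] := second_difference_le dg ddg bd.
exists K; split => // x d xd.
have ct : continuous (fun t : R => theta (x + cis t *: d)).
  by apply: continuous_circle => t; apply: c0; exact: disc_circle.
have ct' : continuous (fun t : R => theta (x + cis t *: - d)).
  apply: continuous_circle => t; apply: c0; rewrite scalerN -scaleNr.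
  by apply: xd; rewrite sqmodN sqmod_cis.
have sh : mean (fun t => theta (x + cis t *: - d)) = mean (fun t => theta (x + cis t *: d)).
  rewrite -(mean_shift ct); last by move=> t; rewrite cis_period.
  by apply: eq_mean => t; rewrite circle_antipodal scalerN scaleNr.
have c3 : continuous (fun t : R => - (2 * theta x) : R) by move=> t; exact: cvg_cst.
have c4 : continuous (fun t : R => theta (x + cis t *: d) + theta (x + cis t *: - d)).
  by move=> t; exact: contD (ct t) (ct' t).
have E : mean (fun t => theta (x + cis t *: d) + theta (x + cis t *: - d) + - (2 * theta x)) =
    2 * (mean (fun t => theta (x + cis t *: d)) - theta x).
  by rewrite (meanD c4 c3) (meanD ct ct') sh mean_cst; ring.
have bnd t : `|theta (x + cis t *: d) + theta (x + cis t *: - d) + - (2 * theta x)| <= K * sqnorm d.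
  have := HK x (cis t *: d); rewrite sqnormZ sqmod_cis mul1r.
  have Ux := disc_center xd; have Up := disc_circle t xd.
  have Um : U (x - cis t *: d).
    by rewrite -scaleNr; apply: xd; rewrite sqmodN sqmod_cis.
  by rewrite /g !extend0_in// scalerN.
have h1 : - (K * sqnorm d) <= 2 * (mean (fun t => theta (x + cis t *: d)) - theta x).
  rewrite -E; apply: mean_ge_cst => t; first exact: contD (c4 t) (c3 t).
  by have := bnd t; rewrite ler_norml => /andP[].
have h2 : 2 * (mean (fun t => theta (x + cis t *: d)) - theta x) <= K * sqnorm d.
  rewrite -E; apply: mean_le_cst => t; first exact: contD (c4 t) (c3 t).
  by have := bnd t; rewrite ler_norml => /andP[].
have : 0 <= K * sqnorm d by rewrite mulr_ge0 ?sqnorm_ge0.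
by rewrite ler_norml => h; apply/andP; split; lra.
Qed.

End TestFunctions.

(** * Bump functions *)

Section Flat.
Variable R : realType.
Implicit Types (t s : R) (m : nat).

(** The derivatives of [e^(-1/t)] are combinations of the members of this family,
    which turns its smoothness into an induction. *)
Definition flat m t : R := if 0 < t then t^-1 ^+ m * expR (- t^-1) else 0.

(** At [t = 0] this bound gives the derivative [0], by [is_derive0_quadratic]; it
    comes from comparing [e^(1/t)] with the term of degree [m + 2] of its series. *)
Lemma flat_bound m : exists C : R, 0 <= C /\ forall t, `|flat m t| <= C * t ^+ 2.
Proof.
exists ((m.+2)`!%:R); split => // t; rewrite /flat; case: ifP => t0; last first.
  by rewrite normr0 mulr_ge0 ?sqr_ge0.
have ti0 : 0 < t^-1 by rewrite invr_gt0.
rewrite ger0_norm; last by rewrite mulr_ge0 ?expR_ge0// exprn_ge0// ltW.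
have := expR_ge1Dxn m.+1 (ltW ti0) => h.
have h2 : t^-1 ^+ m.+2 / (m.+2)`!%:R <= expR t^-1 by apply: le_trans h; rewrite lerDr.
rewrite expRN ler_pdivrMr ?expR_gt0//.
move: h2; rewrite ler_pdivrMr ?ltr0n ?fact_gt0// => h2.
have -> : t^-1 ^+ m = t ^+ 2 * t^-1 ^+ m.+2.
  have tt : t * t^-1 = 1 by rewrite divff// gt_eqF.
  have aux (u w : R) : t * u = 1 -> w = t ^+ 2 * (u * (u * w)).
    by move=> tu; rewrite -[LHS]mul1r -(expr1n _ 2) -tu; ring.
  by rewrite !(exprS t^-1); exact: aux.
by rewrite [leRHS]mulrAC [leRHS]mulrC ler_wpM2l ?sqr_ge0// mulrC.
Qed.

Lemma is_derive0_quadratic (f : R -> R) (C : R) : (forall t, `|f t| <= C * t ^+ 2) ->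
  is_derive (0 : R) 1 f 0.
Proof.
move=> fC.
have f0 : f 0 = 0 by apply/eqP; rewrite -normr_le0; have := fC 0; rewrite expr0n mulr0.
have cv : (fun h : R => h^-1 *: (f (h *: 1 + 0) - f 0)) @ 0^' --> (0 : R).
  apply/(@cvgrPdist_le R R) => e e0.
  have C0 : 0 <= C by have := fC 1; rewrite expr1n mulr1; exact: le_trans.
  have C1 : 0 < C + 1 by rewrite ltr_wpDl.
  have eC : 0 < e / (C + 1) by rewrite divr_gt0.
  have nh : \forall h \near (0 : R)^', `|h| <= e / (C + 1) by exact: (@dnbhs0_le R R).
  near=> h.
  have h0 : h != 0 by near: h; exact: nbhs_dnbhs_neq.
  rewrite sub0r normrN f0 subr0 addr0 /GRing.scale/= mulr1 normrM normfV.
  rewrite ler_pdivrMl ?normr_gt0//; apply: le_trans (fC h) _.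
  rewrite -real_normK ?num_real// expr2 mulrA [X in _ <= X]mulrC ler_wpM2r//.
  have : `|h| <= e / (C + 1) by near: h.
  by rewrite (ler_pdivlMr _ _ C1); have := normr_ge0 h; lra.
apply: DeriveDef; first by apply/cvg_ex; exists 0.
exact: cvg_lim cv.
Unshelve. all: by end_near. Qed.

Lemma is_derive_flat m t :
  is_derive t 1 (flat m) (- (m%:R * flat m.+1 t) + flat m.+2 t).
Proof.
have [t0|t0|t0] := ltgtP t 0.
- have E : \forall s \near t, cst 0 s = flat m s.
    near=> s; rewrite /flat ltNge ifF//=; apply/negbF; apply: ltW.
    by near: s; exact: lt_nbhsl.
  have -> : - (m%:R * flat m.+1 t) + flat m.+2 t = 0.
    by rewrite /flat ltNge (ltW t0)/= mulr0 oppr0 addr0.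
  by apply: near_eq_is_derive E _; exact: is_derive_cst.
- have E : \forall s \near t, (fun s : R => s^-1 ^+ m * expR (- s^-1)) s = flat m s.
    near=> s; rewrite /flat ifT//; near: s; exact: lt_nbhsr.
  apply: near_eq_is_derive E _.
  have dV : is_derive t 1 (fun s : R => s^-1) (- t^-1 ^+ 2).
    have tn0 : id t != 0 by rewrite gt_eqF.
    have := is_deriveV tn0 (is_derive_id t 1).
    by rewrite /GRing.scale/= mulr1 exprVn.
  have dE : is_derive t 1 (fun s : R => expR (- s^-1)) (expR (- t^-1) * t^-1 ^+ 2).
    have dN := is_deriveN dV; rewrite opprK in dN.
    exact: (@is_derive1_comp _ expR (fun s => - s^-1) t _ _ (is_derive_expR _) dN).
  have fE : ((fun s : R => s^-1) ^+ m) * (fun s : R => expR (- s^-1)) =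
      (fun s : R => s^-1 ^+ m * expR (- s^-1)).
    by apply/funext => s; rewrite mulrfctE exprfctE.
  have := is_deriveM (is_deriveX m dV) dE.
  rewrite fE exprfctE /GRing.scale/=; congr (is_derive _ _ _ _).
  have aux (u E w c : R) : u * w * (E * u ^+ 2) + E * (c * w * - u ^+ 2) =
      - (c * (u * (u * w) * E)) + u * (u * (u * w)) * E by ring.
  rewrite /flat t0; case: (m) => [|k].
    by rewrite mulr0n !mul0r mulr0 oppr0 addr0 add0r expr0 mul1r mulrC.
  rewrite (exprS _ k.+2) (exprS _ k.+1) (exprS _ k); exact: aux.
- rewrite t0; have [C [C0 fC]] := flat_bound m.
  have -> : - (m%:R * flat m.+1 0) + flat m.+2 0 = 0 :> R.
    by rewrite /flat ltxx mulr0 oppr0 addr0.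
  exact: is_derive0_quadratic fC.
Unshelve. all: by end_near. Qed.

End Flat.

Section Bump.
Variables (R : realType) (n : nat).
Local Notation CC := 'CC[R]_n.

(** This class contains the bump functions and is closed under directional
    derivatives, so that continuity of its members gives their smoothness by
    induction on the order. *)
Inductive elementary : (CC -> R) -> Prop :=
| elementary_cst (c : R) : elementary (fun _ => c)
| elementary_Re i : elementary (fun x => Re (x 0 i))
| elementary_Im i : elementary (fun x => Im (x 0 i))
| elementaryD f g : elementary f -> elementary g -> elementary (fun x => f x + g x)
| elementaryM f g : elementary f -> elementary g -> elementary (fun x => f x * g x)
| elementary_flat m f : elementary f -> elementary (fun x => flat m (f x)).

Lemma continuous_flat m : continuous (@flat R m).
Proof. by move=> t; exact: derive_continuous_at (is_derive_flat m t). Qed.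

Lemma continuous_elementary f : elementary f -> forall x, {for x, continuous f}.
Proof.
elim=> [c|i|i|g h _ cg _ ch|g h _ cg _ ch|m g _ cg] x.
- exact: cont_cst.
- exact: continuous_coord_Re.
- exact: continuous_coord_Im.
- exact: contD (cg x) (ch x).
- exact: contM (cg x) (ch x).
- exact: continuous_comp (cg x) (@continuous_flat m _).
Qed.

Lemma is_derive_affine (a b t : R) : is_derive t 1 (fun s : R => a + s * b) b.
Proof.
rewrite (_ : (fun s : R => _) = (fun s : R => b * s + a)); last first.
  by apply/funext => s; rewrite addrC mulrC.
rewrite -[X in is_derive _ _ _ X]addr0.
exact: (is_deriveD (is_derive_scale t b) (is_derive_cst a t 1)).
Qed.

Lemma elementary_derive f : elementary f -> forall v : CC, exists g,
  elementary g /\ forall x, is_derive (0 : R) 1 (real_line f x v) (g x).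
Proof.
have E0 (h : CC -> R) x v : real_line h x v 0 = h x.
  by rewrite /real_line scale0r addr0.
elim=> [c|i|i|g h eg IHg eh IHh|g h eg IHg eh IHh|m g eg IHg] v.
- by exists (fun=> 0); split; [exact: elementary_cst|move=> x; exact: is_derive_cst].
- exists (fun=> Re (v 0 i)); split; first exact: elementary_cst.
  move=> x; rewrite (_ : real_line _ x v = (fun s : R => Re (x 0 i) + s * Re (v 0 i))).
    exact: is_derive_affine.
  by apply/funext => s; rewrite /real_line !mxE complex_ReD complex_ReM /= mul0r subr0.
- exists (fun=> Im (v 0 i)); split; first exact: elementary_cst.
  move=> x; rewrite (_ : real_line _ x v = (fun s : R => Im (x 0 i) + s * Im (v 0 i))).
    exact: is_derive_affine.
  by apply/funext => s; rewrite /real_line !mxE complex_ImD complex_ImM /= mul0r addr0.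
- have [g' [eg' dg]] := IHg v; have [h' [eh' dh]] := IHh v.
  exists (fun x => g' x + h' x); split; first exact: elementaryD.
  by move=> x; exact: is_deriveD (dg x) (dh x).
- have [g' [eg' dg]] := IHg v; have [h' [eh' dh]] := IHh v.
  exists (fun x => g x * h' x + h x * g' x); split.
    by apply: elementaryD; exact: elementaryM.
  by move=> x; have := is_deriveM (dg x) (dh x); rewrite !E0.
- have [g' [eg' dg]] := IHg v.
  exists (fun x => (- (m%:R) * flat m.+1 (g x) + flat m.+2 (g x)) * g' x); split.
    apply: elementaryM => //; apply: elementaryD; last exact: elementary_flat.
    by apply: elementaryM; [exact: elementary_cst|exact: elementary_flat].
  move=> x; have d1 := is_derive_flat m (real_line g x v 0).
  have := @is_derive1_comp _ (flat m) (real_line g x v) 0 _ _ d1 (dg x).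
  by rewrite E0 mulNr.
Qed.

Lemma elementary_smooth f U : elementary f -> smooth_on U f.
Proof.
move=> ef k; elim: k f ef => [|k IH] f ef; split.
- by move=> z _; exact: continuous_elementary.
- by [].
- by move=> z _; exact: continuous_elementary.
- move=> v; have [g [eg dg]] := elementary_derive ef v; split.
    by move=> z _; have [] := dg z.
  rewrite (_ : (fun z => _) = g); first exact: IH.
  by apply/funext => z; rewrite derive1E; have [_] := dg z.
Qed.

Lemma elementary_sqnorm (p : CC) : elementary (fun x => sqnorm (x - p)).
Proof.
have sq (f : CC -> R) (c : R) : elementary f -> elementary (fun x => (f x + - c) * (f x + - c)).
  by move=> ef; apply: elementaryM; apply: elementaryD => //; exact: elementary_cst.
have term i : elementary (fun x : CC => (Re (x 0 i) + - Re (p 0 i)) * (Re (x 0 i) + - Re (p 0 i)) +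
    (Im (x 0 i) + - Im (p 0 i)) * (Im (x 0 i) + - Im (p 0 i))).
  by apply: elementaryD; apply: sq; [exact: elementary_Re|exact: elementary_Im].
rewrite (_ : (fun x => _) = (fun x : CC => \sum_(i <- index_enum 'I_n)
    ((Re (x 0 i) + - Re (p 0 i)) * (Re (x 0 i) + - Re (p 0 i)) +
    (Im (x 0 i) + - Im (p 0 i)) * (Im (x 0 i) + - Im (p 0 i))))); last first.
  apply/funext => x; apply: eq_bigr => i _.
  by rewrite !mxE /sqmod complex_ReD complex_ImD complex_ReN complex_ImN !expr2.
elim: (index_enum _) => [|i s IH].
  rewrite (_ : (fun x => _) = (fun=> 0)); first exact: elementary_cst.
  by apply/funext => x; rewrite big_nil.
set F := (fun x : CC => _) in IH.
rewrite (_ : (fun x => _) = (fun x : CC => ((Re (x 0 i) + - Re (p 0 i)) * (Re (x 0 i) + - Re (p 0 i)) +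
    (Im (x 0 i) + - Im (p 0 i)) * (Im (x 0 i) + - Im (p 0 i))) + F x)).
  exact: elementaryD.
by apply/funext => x; rewrite big_cons.
Qed.

Definition bump (p : CC) (e : R) (x : CC) : R := flat 0 (e - sqnorm (x - p)).

Lemma bump_smooth p e U : smooth_on U (bump p e).
Proof.
apply: elementary_smooth; apply: elementary_flat.
rewrite (_ : (fun x => _) = (fun x => e + (-1) * sqnorm (x - p))).
  apply: elementaryD; first exact: elementary_cst.
  by apply: elementaryM; [exact: elementary_cst|exact: elementary_sqnorm].
by apply/funext => x; rewrite mulN1r.
Qed.

Lemma bump_center p e : 0 < e -> 0 < bump p e p.
Proof. by move=> e0; rewrite /bump subrr sqnorm0 subr0 /flat e0 expr0 mul1r expR_gt0. Qed.

Lemma bump_out p e x : e <= sqnorm (x - p) -> bump p e x = 0.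
Proof. by move=> ex; rewrite /bump /flat subr_gt0 ltNge ex. Qed.

Lemma bump_support U p e : (forall x, sqnorm (x - p) <= e -> U x) ->
  compact_support_in U (bump p e).
Proof.
move=> eU S.
pose T : set CC := [set x | sqnorm (x - p) <= e]%classic.
have cT : closed T.
  apply: (@preimage_closed _ _ (fun x : CC => sqnorm (x - p)) [set r | r <= e]%classic).
    by move=> x _; exact: continuous_sqnorm.
  exact: closed_le.
have kT : compact T.
  apply: subclosed_compact cT (@compact_sqnorm R n (2 * e + 2 * sqnorm p)) _ => x.
  by rewrite /T/= => xe; have := sqnormD_le (x - p) p; rewrite subrK; lra.
have ST : (S `<=` T)%classic.
  rewrite /S ((closure_id T).1 cT); apply: closureS => x [_ bx].
  by rewrite /T/= leNgt; apply: contra bx => ex; rewrite bump_out// ltW.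
split; first exact: subclosed_compact (@closed_closure _ _) kT ST.
by move=> x /ST; exact: eU.
Qed.

(** After adding a small multiple of a bump at [p], the value at [p] exceeds the
    constant value taken on a small circle around [p]. *)
Lemma constant_not_strictly_psh (i0 : 'I_n) (U W : set CC) (phi : CC -> \bar R) (c : R) p :
  open U -> open W -> U p -> W p -> (forall x, W x -> phi x = c%:E) ->
  ~ strictly_psh U phi.
Proof.
move=> oU oW Up Wp phic [_ _ strict].
have : \forall x \near p, U x /\ W x.
  by apply: filterI; apply: open_nbhs_nbhs.
move=> /near_sqnorm[e [e0 eUW]].
have e4 : 0 < e / 4 by rewrite divr_gt0.
have supp : compact_support_in U (bump p (e / 4)).
  by apply: bump_support => x xe; apply: (eUW x _).1; lra.
(* The bump vanishes outside the ball of squared radius [e / 4], hence on the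
   circle of squared radius [e / 2] used below. *)
have [eps0 [eps00 H]] := strict _ (@bump_smooth p (e / 4) U) supp.
have := H (eps0 / 2) _; set psi := (fun z => _) => /(_ ltac:(apply/andP; split; lra)) ppsi.
pose d : CC := ((Num.sqrt (e / 2))%:C : R[i]) *: delta_mx 0 i0.
have sd : sqnorm d = e / 2.
  rewrite /d sqnormZ sqmod_real sqr_sqrtr ?divr_ge0 ?(ltW e0)//.
  rewrite /sqnorm (bigD1 i0)//= big1; last first.
    by move=> i ii0; rewrite mxE eqxx (negbTE ii0) /sqmod/= expr0n addr0.
  by rewrite mxE !eqxx /sqmod/= expr1n expr0n !addr0 mulr1.
have disc : disc_in U p d.
  move=> w w1; apply: (eUW (p + w *: d) _).1.
  rewrite addrAC subrr add0r sqnormZ sd; have := sqmod_ge0 w; nra.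
have := psh_disc ppsi disc.
have psiE t : psi (p + cis t *: d) = c%:E.
  have dist : sqnorm (p + cis t *: d - p) = e / 2.
    by rewrite addrAC subrr add0r sqnormZ sqmod_cis mul1r.
  rewrite /psi bump_out ?mulr0 ?adde0; last by rewrite dist; lra.
  by apply: phic; apply: (eUW (p + cis t *: d) _).2; rewrite dist; lra.
under eq_integral => t _ do rewrite psiE.
rewrite (@meanE _ (fun=> c)); last by move=> t; exact: cvg_cst.
rewrite mean_cst /psi phic// -EFinD lee_fin => hc.
have := bump_center p e4; nra.
Qed.

End Bump.

(** * Strict plurisubharmonicity and the cores *)

Section Ball.
Variables (R : realType) (n : nat) (i0 i1 : 'I_n).
Hypothesis i10 : i1 != i0.
Local Notation CC := 'CC[R]_n.

(** The centre is at distance [1/8] from the axis and the radius of the ball is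
    [1/16], so that [|w| > 1/16] and [|z| < 1/16] on the ball, as [dfun_gain]
    requires. *)
Definition ball_center : CC := ((8^-1)%:C : R[i]) *: delta_mx 0 i1.

Definition ball_omega : set CC := [set x | sqnorm (x - ball_center) < 256^-1]%classic.

Lemma ball_centerE i : sqmod (ball_center 0 i) = if i == i1 then 64^-1 else 0.
Proof.
rewrite !mxE eqxx sqmodM sqmod_real/=; case: ifP => _.
  by rewrite mulr1n /sqmod/=; field.
by rewrite mulr0n /sqmod/=; ring.
Qed.

Lemma sqnorm_ball_center : sqnorm ball_center = 64^-1.
Proof.
rewrite /sqnorm (bigD1 i1)//= big1 ?addr0; first by rewrite ball_centerE eqxx.
by move=> i /negbTE ii1; rewrite ball_centerE ii1.
Qed.

Lemma ball_omega_center : ball_omega ball_center.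
Proof. by rewrite /ball_omega/= subrr sqnorm0 invr_gt0 ltr0n. Qed.

Lemma open_ball_omega : open ball_omega.
Proof.
apply: (@open_comp _ _ (fun x : CC => sqnorm (x - ball_center)) [set r | r < 256^-1]%classic).
  by move=> x _; exact: continuous_sqnorm.
exact: open_lt.
Qed.

Lemma ball_omega_bounds x : ball_omega x ->
  [/\ sqmod (x 0 i0) <= 256^-1, 256^-1 <= sqmod (x 0 i1) & transv i0 x < 16^-1].
Proof.
rewrite /ball_omega/= => xp.
have c0 := sqmod_le_sqnorm (x - ball_center) i0.
have c1 := sqmod_le_sqnorm (ball_center - x) i1.
have xN : sqnorm (ball_center - x) = sqnorm (x - ball_center).
  by apply: eq_bigr => i _; rewrite -opprB !mxE sqmodN.
have x0 : (x - ball_center) 0 i0 = x 0 i0.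
  by rewrite !mxE eq_sym (negbTE i10) andbF mulr0 subr0.
rewrite x0 in c0; split; first by lra.
- have := sqmodD_le ((ball_center - x) 0 i1) (x 0 i1).
  rewrite [(ball_center - x) 0 i1]mxE [(- x) 0 i1]mxE subrK ball_centerE eqxx.
  move: c1; rewrite [(ball_center - x) 0 i1]mxE [(- x) 0 i1]mxE xN; lra.
- have := sqnormD_le (x - ball_center) ball_center.
  rewrite subrK sqnorm_ball_center (sqnorm_transv i0 x).
  by have := sqmod_ge0 (x 0 i0); lra.
Qed.

Lemma ball_omega_Omega : (ball_omega `<=` Omega i0)%classic.
Proof. by move=> x /ball_omega_bounds[x0 _ xw]; apply: Omega_cylinder xw; lra. Qed.

(** The loss [eps K |d|^2] caused by a test function is at most the gain
    [kappa |d|^2] of [dfun_gain]. *)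
Lemma strictly_psh_phi_star : strictly_psh ball_omega (@phi_star R n i0).
Proof.
split.
- by move=> z _; rewrite ltry.
- by exists ball_center; split; [exact: ball_omega_center|].
move=> theta stheta ctheta.
have [K [K0 HK]] := mean_test_function open_ball_omega stheta ctheta.
pose kappa : R := expR (-1) / 512.
have kappa0 : 0 < kappa by rewrite divr_gt0 ?expR_gt0 ?ltr0n.
have K1 : 0 < K + 1 by rewrite ltr_wpDl.
exists (kappa / (K + 1)); split; first exact: divr_gt0.
move=> eps /andP[e1 e2].
have eK : `|eps| * K <= kappa.
  have : `|eps| <= kappa / (K + 1) by rewrite ler_norml; apply/andP; split; exact: ltW.
  rewrite ler_pdivlMr// => h; apply: le_trans h; rewrite ler_wpM2l//; lra.
have ctheta0 x : ball_omega x -> {for x, continuous theta} := (stheta 0%N).1 x.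
have cg x : ball_omega x -> {for x, continuous (fun y => eps * theta y + -1)}.
  by move=> /ctheta0 ct; apply: contD; [apply: contM => //|]; exact: cont_cst.
rewrite (_ : (fun z => _) = (fun z => (dfun_lim i0 z + (eps * theta z + -1))%:E)); last first.
  by apply/funext => z; rewrite -EFinD addrAC addrA.
apply: psh_dfun_lim cg _ => k x d xd.
have cth : continuous (fun t : R => theta (x + cis t *: d)).
  by apply: continuous_circle => t; apply: ctheta0; exact: disc_circle.
have cd : continuous (fun t : R => dfun i0 k (x + cis t *: d)).
  by apply: continuous_circle => t; exact: continuous_dfun.
have ceth : continuous (fun t : R => eps * theta (x + cis t *: d)).
  by move=> t; apply: contM (cth t); exact: cont_cst.
rewrite meanD//; last by move=> t; apply: contD (ceth t) _; exact: cont_cst.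
rewrite meanD//; last by move=> t; exact: cont_cst.
rewrite meanZ// mean_cst.
have [_ x1 _] := ball_omega_bounds (disc_center xd).
have gain := @dfun_gain R n i0 k i1 x d i10
  (fun w w1 => let: And3 h _ _ := ball_omega_bounds (xd w w1) in h) x1.
have := HK x d xd; set D := mean _ => dev.
have d0 := sqnorm_ge0 d.
have : `|eps * (D - theta x)| <= kappa * sqnorm d.
  rewrite normrM; apply: le_trans (ler_wpM2l (normr_ge0 _) dev) _.
  by rewrite mulrA ler_wpM2r.
rewrite mulrBr ler_norml => /andP[dev1 _]; rewrite -/kappa in gain.
by clearbody kappa; lra.
Qed.

End Ball.

Theorem theorem1 (R : realType) (n : nat) (n_ge2 : (2 <= n)%N) :
  exists Omega omega : set 'CC[R]_n,
    [/\ domain Omega /\ pseudoconvex Omega,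
        open omega /\ omega !=set0 /\ omega `<=` Omega,
        (exists phi : 'CC[R]_n -> \bar R,
           [/\ PSH_star Omega phi,
               forall z, Omega z -> (phi z < 0)%E
             & strictly_psh omega phi]),
        (forall phi : 'CC[R]_n -> \bar R,
           PSH_zero Omega phi ->
           (forall z, Omega z -> (phi z < 0)%E) ->
           exists c : R, forall z, omega z -> phi z = c%:E)
      & core_star Omega <> core_zero Omega].
Proof.
pose i0 : 'I_n := Ordinal (ltnW n_ge2); pose i1 : 'I_n := Ordinal n_ge2.
have i10 : i1 != i0 by [].
pose omega := @ball_omega R n i1.
have bounds x : omega x -> sqmod (x 0 i0) <= 1 /\ transv i0 x < 16^-1.
  by move=> /(ball_omega_bounds i10)[? _ ?]; split=> //; lra.
have rigid phi : PSH_zero (Omega i0) phi -> bounded_above_on (Omega i0) phi ->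
    exists c : R, forall z, omega z -> phi z = c%:E.
  move=> zphi bphi; have [c phic] := constant_cylinder zphi bphi.
  by exists c => z /bounds[z0 zw]; exact: phic.
exists (Omega i0), omega; split.
- by split; [exact: domain_Omega|exact: pseudoconvex_Omega].
- split; first exact: open_ball_omega.
  by split; [exists (ball_center _ i1); exact: ball_omega_center|exact: ball_omega_Omega].
- exists (@phi_star R n i0); split; first exact: phi_star_PSH.
    exact: phi_star_lt0.
  exact: strictly_psh_phi_star.
- move=> phi zphi phi0; apply: rigid => //.
  by exists 0 => z Oz; exact/ltW/phi0.
pose p := ball_center R i1.
have Wp : omega p := @ball_omega_center R n i1.
have Op : Omega i0 p := ball_omega_Omega i10 Wp.
move=> cores; have : core_zero (Omega i0) p.
  split=> // phi zphi bphi [U [oU Up _ sphi]].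
  have [c phic] := rigid _ zphi bphi.
  exact: (constant_not_strictly_psh i0 oU (@open_ball_omega R n i1) Up Wp phic sphi).
rewrite -cores => -[_ /(_ (@phi_star R n i0))]; apply.
- exact: phi_star_PSH.
- by exists 0 => z Oz; exact/ltW/phi_star_lt0.
- exists omega; split=> //; [exact: open_ball_omega|exact: ball_omega_Omega|].
  exact: strictly_psh_phi_star.
Qed.
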